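(* Let $D_1$ and $D_2$ be negative discriminants (negative integers congruent to $0$ or $1$ modulo $4$). Then $$\widehat{C}(D_1)\simeq\widehat{C}(D_2)\ \text{ as (abstract) groups}\quad\Longleftrightarrow\quad\mathbb{Q}(\sqrt{D_1})=\mathbb{Q}(\sqrt{D_2}).$$
   Context: $\widehat{\mathbb{Z}}=\varprojlim_N\mathbb{Z}/N\mathbb{Z}$. For a negative integer $D\equiv 0,1\pmod 4$ the group $\widehat{C}(D)$ (the adelic framed form class group of discriminant $D$) is defined as follows. Adelic framed forms. $\mathcal{Q}(D)$ is the set of primitive positive definite binary quadratic forms $ax^2+bxy+cy^2\in\mathbb{Z}[x,y]$ with $b^2-4ac=D$. For $Q\in\mathcal{Q}(D)$ and $\alpha\in\mathrm{SL}_2(\mathbb{Z})$ put $Q^\alpha=Q\left(\alpha\begin{bmatrix}x\\ y\end{bmatrix}\right)$. Let $$\widehat{\mathcal{Q}}(D)=\left\{(Q,\gamma)\in\mathcal{Q}(D)\times\mathrm{SL}_2(\widehat{\mathbb{Z}})\;\middle|\; Q\left(\gamma\begin{bmatrix}1\\0\end{bmatrix}\right)\in\widehat{\mathbb{Z}}^\times\right\}.$$ $\mathrm{SL}_2(\mathbb{Z})$ (embedded diagonally in $\mathrm{SL}_2(\widehat{\mathbb{Z}})$) acts on the right on $\widehat{\mathcal{Q}}(D)$ by $(Q,\gamma)^\alpha=(Q^\alpha,\alpha^{-1}\gamma)$. $\widehat{C}(D)$ is the set of orbits, and $[(Q,\gamma)]$ denotes the orbit of $(Q,\gamma)$. It is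 a group under the well-defined operation $\mathcal{C}\cdot\mathcal{C}'=[(R,\nu)]$ given by the following construction. Composition construction. Let $Q_0=a_0x^2+b_0xy+c_0y^2$ be the principal form: $x^2+xy+\frac{1-D}{4}y^2$ if $D\equiv1\pmod 4$, and $x^2-\frac{D}{4}y^2$ if $D\equiv 0\pmod 4$. Given $\mathcal{C}=[(Q,\gamma)]$ and $\mathcal{C}'=[(Q',\gamma')]$ in $\widehat{C}(D)$, a pair $(R,\nu)\in\widehat{\mathcal{Q}}(D)$ is constructed as follows. Step 1. Put $Q_1=Q=a_1x^2+b_1xy+c_1y^2$. Choose $\alpha\in\mathrm{SL}_2(\mathbb{Z})$ such that $Q_2=Q'^{\alpha}=a_2x^2+b_2xy+c_2y^2$ satisfies $\gcd\left(a_1,a_2,\frac{b_1+b_2}{2}\right)=1$, and choose an integer $B$ with $B\equiv b_1\pmod{2a_1}$, $B\equiv b_2\pmod{2a_2}$, $B^2\equiv D\pmod{4a_1a_2}$ (such $\alpha$ and $B$ exist). Put $R=Ax^2+Bxy+Cy^2$ with $A=a_1a_2$, $C=\frac{B^2-D}{4a_1a_2}$, and $\beta_1=\gamma$, $\beta_2=\alpha^{-1}\gamma'$, so that $\mathcal{C}=[(Q_1,\beta_1)]$, $\mathcal{C}'=[(Q_2,\beta_2)]$. Step 2. Write $\beta_i^{-1}=\begin{bmatrix}u_i&v_i\\ r_i&s_i\end{bmatrix}$ and put $\mu_i=s_i+r_i\frac{B-b_i}{2a_i}\in\widehat{\mathbb{Z}}$ $(i=1,2)$, $r=-Br_1r_2+a_2r_1\mu_2+a_1r_2\mu_1$,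 $s=\mu_1\mu_2-Cr_1r_2$. Write $Q_i\left(\beta_i\begin{bmatrix}x\\ y\end{bmatrix}\right)=\widehat{a}_ix^2+\widehat{b}_ixy+\widehat{c}_iy^2\in\widehat{\mathbb{Z}}[x,y]$; here $\widehat{a}_i\in\widehat{\mathbb{Z}}^\times$. Put $\widehat{a}=\widehat{a}_1\widehat{a}_2\in\widehat{\mathbb{Z}}^\times$; one has $R(s,-r)=\widehat{a}$. Step 3. Choose $u_0,v_0\in\widehat{\mathbb{Z}}$ with $u_0s-v_0r=1$ (e.g. $u_0=\widehat{a}^{-1}(As-Br)$, $v_0=-\widehat{a}^{-1}Cr$). Put $m=-2Av_0s+B(u_0s+v_0r)-2Cu_0r$, $\widehat{b}=b_0+2\widehat{a}_2^{-1}\left(\frac{\widehat{b}_1-b_0}{2}\right)+2\left(\frac{\widehat{b}_2-b_0}{2}\right)$ (where $\frac{\widehat{b}_i-b_0}{2}\in\widehat{\mathbb{Z}}$), $k=\frac{m-\widehat{b}}{2\widehat{a}}\in\widehat{\mathbb{Z}}$, $u=u_0+kr$, $v=v_0+ks$, and $$\nu=\begin{bmatrix}u&v\\ r&s\end{bmatrix}^{-1}=\begin{bmatrix}s&-v\\-r&u\end{bmatrix}\in\mathrm{SL}_2(\widehat{\mathbb{Z}}).$$ Then $(R,\nu)\in\widehat{\mathcal{Q}}(D)$, and one sets $\mathcal{C}\cdot\mathcal{C}'=[(R,\nu)]$. *)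

(* Defs.v *)
From HB Require Import structures.
From mathcomp Require Import all_boot all_order all_algebra all_field.
From mathcomp Require Import generic_quotient ring.
From mathcomp Require Import boolp classical_sets.

Set Implicit Arguments.
Unset Strict Implicit.
Unset Printing Implicit Defensive.

Import Order.TTheory GRing.Theory Num.Theory.
Local Open Scope ring_scope.
Local Open Scope quotient_scope.

(** * The profinite integers *)

(* The moduli are the n.+2, for which 'I_n.+2 is the ring Z/(n+2)Z; the modulus
   1 is left out because its factor in the inverse limit is trivial. *)
Definition zhat_compatible (x : forall n, 'I_n.+2) : Prop :=
  forall m n, (m.+2 %| n.+2)%N -> x m = inZp (x n).

Record Zhat := MkZhat {
  zres :> forall n, 'I_n.+2;
  zres_compatible : zhat_compatible zres
}.

HB.instance Definition _ := gen_eqMixin Zhat.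
HB.instance Definition _ := gen_choiceMixin Zhat.

Lemma zhatP (x y : Zhat) : (forall n, x n = y n) -> x = y.
Proof.
case: x y => [x Hx] [y Hy] /= xy.
have E : x = y by exact: functional_extensionality_dep.
by subst y; rewrite (Prop_irrelevance Hx Hy).
Qed.

Lemma inZp_inZp m n (a : nat) : (m.+2 %| n.+2)%N ->
  inZp (inZp a : 'I_n.+2) = inZp a :> 'I_m.+2.
Proof. by move=> mn; apply: val_inj; rewrite /= modn_dvdm. Qed.

Lemma zhat0_compatible : zhat_compatible (fun n => 0).
Proof. by move=> m n mn; apply: val_inj; rewrite /= mod0n. Qed.
Definition zhat0 := MkZhat zhat0_compatible.

Lemma zhat1_compatible : zhat_compatible (fun n => 1).
Proof. by move=> m n mn; apply: val_inj; rewrite /= !modn_small. Qed.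
Definition zhat1 := MkZhat zhat1_compatible.

Lemma zhat_add_compatible (x y : Zhat) : zhat_compatible (fun n => x n + y n).
Proof.
move=> m n mn; rewrite (zres_compatible x mn) (zres_compatible y mn).
by apply: val_inj; rewrite /= modnDm modn_dvdm.
Qed.
Definition zhat_add x y := MkZhat (zhat_add_compatible x y).

Lemma zhat_mul_compatible (x y : Zhat) : zhat_compatible (fun n => x n * y n).
Proof.
move=> m n mn; rewrite (zres_compatible x mn) (zres_compatible y mn).
by apply: val_inj; rewrite /= modnMm modn_dvdm.
Qed.
Definition zhat_mul x y := MkZhat (zhat_mul_compatible x y).

Lemma zhat_opp_compatible (x : Zhat) : zhat_compatible (fun n => - x n).
Proof.
move=> m n mn; apply: (addIr (x m)); rewrite addNr (zres_compatible x mn).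
have H0 : (((- x n)%R + x n) %% n.+2 = 0)%N.
  exact: (congr1 val (addNr (x n))).
apply: val_inj; rewrite /= modnDm -(modn_dvdm ((- x n)%R + x n) mn).
by rewrite H0 mod0n.
Qed.
Definition zhat_opp x := MkZhat (zhat_opp_compatible x).

Lemma zhat_addA : associative zhat_add.
Proof. by move=> x y z; apply: zhatP => n /=; rewrite addrA. Qed.
Lemma zhat_addC : commutative zhat_add.
Proof. by move=> x y; apply: zhatP => n /=; rewrite addrC. Qed.
Lemma zhat_add0 : left_id zhat0 zhat_add.
Proof. by move=> x; apply: zhatP => n /=; rewrite add0r. Qed.
Lemma zhat_addN : left_inverse zhat0 zhat_opp zhat_add.
Proof. by move=> x; apply: zhatP => n /=; rewrite addNr. Qed.

HB.instance Definition _ :=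
  GRing.isZmodule.Build Zhat zhat_addA zhat_addC zhat_add0 zhat_addN.

Lemma zhat_mulA : associative zhat_mul.
Proof. by move=> x y z; apply: zhatP => n /=; rewrite mulrA. Qed.
Lemma zhat_mulC : commutative zhat_mul.
Proof. by move=> x y; apply: zhatP => n /=; rewrite mulrC. Qed.
Lemma zhat_mul1 : left_id zhat1 zhat_mul.
Proof. by move=> x; apply: zhatP => n /=; rewrite mul1r. Qed.
Lemma zhat_mulDl : left_distributive zhat_mul zhat_add.
Proof. by move=> x y z; apply: zhatP => n /=; rewrite mulrDl. Qed.
Lemma zhat_1neq0 : zhat1 != zhat0.
Proof.
by apply/eqP => /(congr1 (fun x : Zhat => val (x 0%N))).
Qed.

HB.instance Definition _ := GRing.Zmodule_isComNzRing.Build Zhat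
  zhat_mulA zhat_mulC zhat_mul1 zhat_mulDl zhat_1neq0.

Definition zhat_unit : {pred Zhat} := fun x => `[< exists y, y * x = 1 >].
Definition zhat_inv (x : Zhat) : Zhat := xget x [set y | y * x = 1].

Lemma zhat_mulVx : {in zhat_unit, left_inverse 1 zhat_inv *%R}.
Proof.
by move=> x /asboolP[y yx]; exact: (@xgetI _ x [set y | y * x = 1]%classic y yx).
Qed.
Lemma zhat_unitPl (x y : Zhat) : y * x = 1 -> zhat_unit x.
Proof. by move=> yx; apply/asboolP; exists y. Qed.
Lemma zhat_inv_out : {in [predC zhat_unit], zhat_inv =1 id}.
Proof.
move=> x; rewrite inE => /negP xN; apply: xgetPN => y yx.
by apply: xN; apply/asboolP; exists y.
Qed.

HB.instance Definition _ := GRing.ComNzRing_hasMulInverse.Build Zhat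
  zhat_mulVx zhat_unitPl zhat_inv_out.

(** * Binary quadratic forms *)

(* a x^2 + b x y + c y^2 *)
Record qform (R : Type) := QForm { qa : R; qb : R; qc : R }.

HB.instance Definition _ R := gen_eqMixin (qform R).
HB.instance Definition _ R := gen_choiceMixin (qform R).

Definition qmap (R S : Type) (f : R -> S) (Q : qform R) : qform S :=
  QForm (f (qa Q)) (f (qb Q)) (f (qc Q)).

Definition qeval (R : comNzRingType) (Q : qform R) (v : 'cV[R]_2) : R :=
  qa Q * v 0 0 ^+ 2 + qb Q * v 0 0 * v 1 0 + qc Q * v 1 0 ^+ 2.

(* The coefficients of Q (g (x, y)^T); see qeval_subst. *)
Definition qsubst (R : comNzRingType) (Q : qform R) (g : 'M[R]_2) : qform R :=
  QForm (qeval Q (col 0 g))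
    (qa Q * (g 0 0 * g 0 1) *+ 2
       + qb Q * (g 0 0 * g 1 1 + g 0 1 * g 1 0)
       + qc Q * (g 1 0 * g 1 1) *+ 2)
    (qeval Q (col 1 g)).

Lemma qeval_subst (R : comNzRingType) (Q : qform R) (g : 'M[R]_2)
  (v : 'cV[R]_2) : qeval (qsubst Q g) v = qeval Q (g *m v).
Proof.
have E i : (g *m v) i 0 = g i 0 * v 0 0 + g i 1 * v 1 0.
  by rewrite mxE !big_ord_recl big_ord0 addr0; congr (_ + g i _ * v _ _);
     apply: val_inj.
rewrite /qeval /= !E /qeval !mxE; ring.
Qed.

Lemma qform_eqP (R : comNzRingType) (Q Q' : qform R) :
  (forall v, qeval Q v = qeval Q' v) -> Q = Q'.
Proof.
case: Q Q' => [a b c] [a' b' c'] E.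
pose w x y : 'cV[R]_2 := \col_i (if i == 0 then x else y).
have F x y : a * x ^+ 2 + b * x * y + c * y ^+ 2
           = a' * x ^+ 2 + b' * x * y + c' * y ^+ 2.
  by have := E (w x y); rewrite /qeval /= !mxE.
have Ea : a = a' by move: (F 1 0); rewrite !expr2 !(mulr1, mulr0, addr0).
have Ec : c = c' by move: (F 0 1); rewrite !expr2 !(mulr1, mulr0, add0r).
subst a' c'; congr QForm.
by move: (F 1 1); rewrite !expr2 !mulr1 => /addIr /addrI.
Qed.

Definition qprimitive (Q : qform int) : Prop :=
  gcdz (qa Q) (gcdz (qb Q) (qc Q)) = 1.

Definition qposdef (Q : qform int) : Prop :=
  forall v : 'cV[int]_2, v != 0 -> 0 < qeval Q v.

Definition qdisc (Q : qform int) : int := qb Q ^+ 2 - 4 * qa Q * qc Q.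

Definition is_form (D : int) (Q : qform int) : Prop :=
  [/\ qprimitive Q, qposdef Q & qdisc Q = D].

Definition neg_discriminant (D : int) : Prop :=
  D < 0 /\ ((D %% 4)%Z = 0 \/ (D %% 4)%Z = 1).

Definition principal_form (D : int) : qform int :=
  if (D %% 4)%Z == 1 then QForm 1 1 ((1 - D) %/ 4)%Z
  else QForm 1 0 ((- D) %/ 4)%Z.

(** * Adelic framed forms and their classes *)

Definition toZhat (n : int) : Zhat := n%:~R.

Definition SL2 (R : comNzRingType) (g : 'M[R]_2) : Prop := \det g = 1.

Definition is_framed (D : int) (X : qform int * 'M[Zhat]_2) : Prop :=
  [/\ is_form D X.1, SL2 X.2
    & qeval (qmap toZhat X.1) (col 0 X.2) \is a GRing.unit].

Definition framed (D : int) : Type :=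
  {X : qform int * 'M[Zhat]_2 | `[< is_framed D X >]}.

HB.instance Definition _ D := Choice.on (framed D).

Definition framed_form D (X : framed D) : qform int := (val X).1.
Definition framed_mx D (X : framed D) : 'M[Zhat]_2 := (val X).2.

Definition framed_act (X : qform int * 'M[Zhat]_2) (alpha : 'M[int]_2) :
    qform int * 'M[Zhat]_2 :=
  (qsubst X.1 alpha, invmx (map_mx toZhat alpha) *m X.2).

Definition same_orbit D : rel (framed D) := fun X Y =>
  `[< exists2 alpha : 'M[int]_2, SL2 alpha & val Y = framed_act (val X) alpha >].

Lemma qsubst1 (R : comNzRingType) (Q : qform R) : qsubst Q 1%:M = Q.
Proof. by apply: qform_eqP => v; rewrite qeval_subst mul1mx. Qed.

Lemma qsubstM (R : comNzRingType) (Q : qform R) (g h : 'M[R]_2) :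
  qsubst (qsubst Q g) h = qsubst Q (g *m h).
Proof. by apply: qform_eqP => v; rewrite !qeval_subst mulmxA. Qed.

Lemma SL2_unitmx (R : comUnitRingType) (g : 'M[R]_2) : SL2 g -> g \in unitmx.
Proof. by move=> g1; rewrite unitmxE g1 unitr1. Qed.

Lemma SL2_map (alpha : 'M[int]_2) : SL2 alpha -> SL2 (map_mx toZhat alpha).
Proof. by rewrite /SL2 /toZhat det_map_mx => ->; rewrite rmorph1. Qed.

Lemma framed_act1 X : framed_act X 1%:M = X.
Proof.
case: X => Q g; rewrite /framed_act /= qsubst1.
by rewrite /toZhat map_mx1 invmx1 mul1mx.
Qed.

Lemma framed_actM X alpha beta : SL2 alpha -> SL2 beta ->
  framed_act (framed_act X alpha) beta = framed_act X (alpha *m beta).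
Proof.
move=> /SL2_map/SL2_unitmx Ua /SL2_map/SL2_unitmx Ub.
rewrite /framed_act /= qsubstM mulmxA; congr (_, _ *m _).
move: Ua Ub; rewrite /toZhat map_mxM /= -[map_mx _ alpha]/(map_mx intr alpha).
set a := map_mx _ alpha; set b := map_mx _ beta => Ua Ub.
have Uab : a *m b \in unitmx by rewrite unitmx_mul Ua.
apply: (can_inj (mulKmx Uab)).
by rewrite -mulmxA [b *m _]mulmxA mulmxV // mul1mx !mulmxV.
Qed.

Lemma same_orbit_refl D : reflexive (@same_orbit D).
Proof.
by move=> X; apply/asboolP; exists 1%:M; rewrite ?framed_act1 // /SL2 det1.
Qed.

Lemma same_orbit_sym D : symmetric (@same_orbit D).
Proof.
have H X Y : @same_orbit D X Y -> @same_orbit D Y X.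
  move=> /asboolP[alpha a1 YX]; apply/asboolP.
  have i1 : SL2 (invmx alpha) by rewrite /SL2 det_inv a1 invr1.
  exists (invmx alpha) => //.
  by rewrite YX framed_actM // mulmxV ?framed_act1 // SL2_unitmx.
by move=> X Y; apply/idP/idP; apply: H.
Qed.

Lemma same_orbit_trans D : transitive (@same_orbit D).
Proof.
move=> Y X Z /asboolP[alpha a1 YX] /asboolP[beta b1 ZY]; apply/asboolP.
exists (alpha *m beta); first by rewrite /SL2 det_mulmx a1 b1 mulr1.
by rewrite ZY YX framed_actM.
Qed.

Canonical same_orbit_equiv D := EquivRel (@same_orbit D)
  (@same_orbit_refl D) (@same_orbit_sym D) (@same_orbit_trans D).

Definition Chat (D : int) := {eq_quot (same_orbit_equiv D)}.

Definition Chat_class D (X : framed D) : Chat D := \pi_(Chat D) X.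

(** * Composition *)

Definition concordant (D : int) (Q1 Q2 : qform int) (B : int) : Prop :=
  [/\ gcdz (qa Q1) (gcdz (qa Q2) ((qb Q1 + qb Q2) %/ 2)%Z) = 1,
      (B = qb Q1 %[mod 2 * qa Q1])%Z,
      (B = qb Q2 %[mod 2 * qa Q2])%Z
    & (B ^+ 2 = D %[mod 4 * qa Q1 * qa Q2])%Z].

Definition composed_form (D : int) (Q1 Q2 : qform int) (B : int) : qform int :=
  QForm (qa Q1 * qa Q2) B ((B ^+ 2 - D) %/ (4 * qa Q1 * qa Q2))%Z.

Definition mx2 (R : Type) (x y z t : R) : 'M[R]_2 :=
  \matrix_(i < 2, j < 2)
    if i == 0 then (if j == 0 then x else y) else (if j == 0 then z else t).

(* [composed_mx D Q1 Q2 B beta1 beta2 nu]: the matrix nu is obtained from the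
   framed forms (Q1, beta1) and (Q2, beta2) for some choice of u0 and v0.
   Division by 2 and by 2 ahat in Zhat is expressed by multiplying out: h1, h2
   and k are unique since 2 is not a zero divisor in Zhat and ahat is a unit. *)
Definition composed_mx (D : int) (Q1 Q2 : qform int) (B : int)
    (beta1 beta2 nu : 'M[Zhat]_2) : Prop :=
  let R := qmap toZhat (composed_form D Q1 Q2 B) in
  let a1 := toZhat (qa Q1) in
  let a2 := toZhat (qa Q2) in
  let b0 := toZhat (qb (principal_form D)) in
  let r1 := invmx beta1 1 0 in
  let s1 := invmx beta1 1 1 in
  let r2 := invmx beta2 1 0 in
  let s2 := invmx beta2 1 1 in
  let mu1 := s1 + r1 * toZhat ((B - qb Q1) %/ (2 * qa Q1))%Z in
  let mu2 := s2 + r2 * toZhat ((B - qb Q2) %/ (2 * qa Q2))%Z in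
  let r := - qb R * r1 * r2 + a2 * r1 * mu2 + a1 * r2 * mu1 in
  let s := mu1 * mu2 - qc R * r1 * r2 in
  let Qh1 := qsubst (qmap toZhat Q1) beta1 in
  let Qh2 := qsubst (qmap toZhat Q2) beta2 in
  let ahat := qa Qh1 * qa Qh2 in
  exists u0 v0 h1 h2 k : Zhat,
    let m := - 2 * qa R * v0 * s + qb R * (u0 * s + v0 * r)
             - 2 * qc R * u0 * r in
    let bhat := b0 + 2 * (qa Qh2)^-1 * h1 + 2 * h2 in
    [/\ u0 * s - v0 * r = 1,
        2 * h1 = qb Qh1 - b0,
        2 * h2 = qb Qh2 - b0,
        2 * ahat * k = m - bhat
      & nu = invmx (mx2 (u0 + k * r) (v0 + k * s) r s)].

Definition composition D (X X' Y : framed D) : Prop :=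
  exists (alpha : 'M[int]_2) (B : int),
    let Q1 := framed_form X in
    let Q2 := qsubst (framed_form X') alpha in
    let beta2 := invmx (map_mx toZhat alpha) *m framed_mx X' in
    [/\ SL2 alpha,
        concordant D Q1 Q2 B,
        framed_form Y = composed_form D Q1 Q2 B
      & composed_mx D Q1 Q2 B (framed_mx X) beta2 (framed_mx Y)].

(* For a negative discriminant D the class of Y exists and depends neither on
   the representatives nor on the choices made in the composition. The value of
   xget is then the only element of the set, and the default c is not used. *)
Definition Chat_mul D (c c' : Chat D) : Chat D :=
  xget c [set d | exists X X' Y : framed D,
    [/\ c = Chat_class X, c' = Chat_class X', d = Chat_class Y
      & composition X X' Y]]%classic.

Definition Chat_isomorphic (D1 D2 : int) : Prop :=
  exists2 f : Chat D1 -> Chat D2,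
    bijective f & {morph f : c c' / Chat_mul c c' >-> Chat_mul c c'}.

(** * Quadratic fields *)

(* The subfield of the algebraic numbers generated by a square root of D. *)
Definition Qsqrt (D : int) : set algC :=
  smallest (fun K : set algC => divring_closed (mem K)) [set sqrtC D%:~R]%classic.

(* Main.v *)
(* To a framed form (Q, gamma), Q = (a, b, c), attach the first column (x, y) of
   gamma, the element theta = 2 a x + (b + sqrt D) y of Zhat[sqrt D], the unit
   N = Q(x, y), which is essentially the norm of theta, and e = bhat - b0. The
   class is determined by e and by theta modulo K^*, where K = Q(sqrt D), and e
   takes all values in 2 Zhat. Composition multiplies theta and N, and sends
   (e, e') to N'^-1 e + e'. So Chat(D) is the semidirect product of the finite
   idele class group of K with Zhat, the idele classes acting through the
   norm, and D only intervenes through K: passing to D f^2 amounts to choosing a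
   representative whose second coordinate y is divisible by f.

   Conversely, commutators lie in the subgroup theta = 1, contain there a copy of
   Zhat, and conjugation by a class multiplies it by N^-1. As additive maps of Zhat
   are Zhat-linear, an isomorphism preserves N. If p splits in Q(sqrt D1), some
   class of Chat(D1) has N = p mod 4 D2; hence a form of discriminant D2 has a
   first coefficient congruent to p mod 4 D2, and p splits in Q(sqrt D2) because
   the Jacobi symbol (D2 / m) only depends on m mod 4 D2. Thus D1 D2 is a square
   modulo almost all primes, and by quadratic reciprocity it is a square. *)

Require Import Defs.
From mathcomp Require Import all_boot all_algebra.
From mathcomp Require Import all_order all_field ring lra zify.
From mathcomp Require Import generic_quotient boolp classical_sets.

Set Implicit Arguments.
Unset Strict Implicit.
Unset Printing Implicit Defensive.

Import Order.TTheory GRing.Theory Num.Theory.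

(** * Gauss's lemma and quadratic reciprocity *)

(* For a prime to m = 2h+1 this is the exponent of -1 in the Jacobi symbol
   (a / m), by Gauss for m prime and by Schering in general. *)
Definition gauss_sign (a h : nat) : bool :=
  \big[addb/false]_(k < h.+1) (h < (a * k) %% h.*2.+1).

Definition in_upper_half (h x : nat) : bool := h < x %% h.*2.+1.
Definition half_rep (h x : nat) : nat :=
  if in_upper_half h x then h.*2.+1 - x %% h.*2.+1 else x %% h.*2.+1.

Lemma half_rep_lt h x : half_rep h x < h.+1.
Proof.
have := ltn_pmod x (ltn0Sn h.*2).
by rewrite /half_rep /in_upper_half; move: (x %% _) => r; move=> L; case: (ltnP h r) => H; lia.
Qed.

Lemma in_upper_half_mod h x : in_upper_half h (x %% h.*2.+1) = in_upper_half h x.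
Proof. by rewrite /in_upper_half modn_mod. Qed.

Lemma in_upper_half_opp h x y : ~~ (h.*2.+1 %| x) -> h.*2.+1 %| x + y ->
  in_upper_half h y = ~~ in_upper_half h x.
Proof.
rewrite /in_upper_half => nx xy; have := divn_eq x h.*2.+1; have := divn_eq y h.*2.+1.
have := ltn_pmod x (ltn0Sn h.*2); have := ltn_pmod y (ltn0Sn h.*2).
move: nx xy; rewrite /dvdn -modnDm.
move: (x %% _) (y %% _) => r s r0 rs sm rm _ _.
have : r + s = h.*2.+1.
  case: (ltnP (r + s) h.*2.+1) => L; first by move: rs; rewrite modn_small //; lia.
  move: rs; rewrite -(subnK L) modnDr modn_small; lia.
lia.
Qed.

Lemma in_upper_half_rep h a x : coprime a h.*2.+1 ->
  in_upper_half h (a * x) = in_upper_half h x (+) in_upper_half h (a * half_rep h x).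
Proof.
move=> co; rewrite /half_rep; case U: (in_upper_half h x) => /=; last first.
  by rewrite -(in_upper_half_mod h (a * (x %% _))) modnMmr in_upper_half_mod.
rewrite (@in_upper_half_opp h (a * x) (a * (h.*2.+1 - x %% h.*2.+1))) ?negbK //.
- rewrite Gauss_dvdr; last by rewrite coprime_sym.
  by apply/negP => /eqP D; move: U; rewrite /in_upper_half D.
- rewrite -mulnDr dvdn_mull //.
  have L := ltn_pmod x (ltn0Sn h.*2).
  rewrite /dvdn -modnDml subnKC ?modnn //; exact: ltnW.
Qed.

Lemma half_rep_inj h b : coprime b h.*2.+1 ->
  injective (fun k : 'I_h.+1 => Ordinal (half_rep_lt h (b * k)) : 'I_h.+1).
Proof.
move=> co; have W (i j : nat) : i <= h -> j <= h -> h.*2.+1 %| b * (i + j) -> i = j.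
  move=> ih jh; rewrite Gauss_dvdr; last by rewrite coprime_sym.
  move=> /dvdnP[[|k] E]; [lia | nia].
have W2 (i j : nat) : i <= j -> j <= h -> h.*2.+1 %| b * (j - i) -> i = j.
  move=> ij jh; rewrite Gauss_dvdr; last by rewrite coprime_sym.
  move=> /dvdnP[[|k] E]; [lia | nia].
move=> i j /(congr1 val) /=; rewrite /half_rep.
have Hi := divn_eq (b * i) h.*2.+1; have Hj := divn_eq (b * j) h.*2.+1.
have li := ltn_pmod (b * i) (ltn0Sn h.*2); have lj := ltn_pmod (b * j) (ltn0Sn h.*2).
have ih : i <= h by rewrite -ltnS.
have jh : j <= h by rewrite -ltnS.
have same : (b * i) %% h.*2.+1 = (b * j) %% h.*2.+1 -> i = j.
  move=> E; apply: val_inj => /=; case/orP: (leq_total i j) => ij.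
    apply: W2 => //; rewrite mulnBr; apply/dvdnP.
    by exists (b * j %/ h.*2.+1 - b * i %/ h.*2.+1); rewrite mulnBl; lia.
  apply/esym; apply: W2 => //; rewrite mulnBr; apply/dvdnP.
  by exists (b * i %/ h.*2.+1 - b * j %/ h.*2.+1); rewrite mulnBl; lia.
have opp : (b * i) %% h.*2.+1 + (b * j) %% h.*2.+1 = h.*2.+1 -> i = j.
  move=> E; apply: val_inj => /=; apply: W => //; rewrite mulnDr /dvdn.
  by rewrite -modnDm E modnn.
case: ifP => _; case: ifP => _ E; first [apply: same; lia | apply: opp; lia].
Qed.

Lemma gaussM h a b : coprime a h.*2.+1 -> coprime b h.*2.+1 ->
  gauss_sign (a * b) h = gauss_sign a h (+) gauss_sign b h.
Proof.
move=> ca cb; rewrite /gauss_sign.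
rewrite [X in _ = X (+) _](reindex_inj (half_rep_inj cb)) -big_split /=.
by apply: eq_bigr => k _; rewrite -!/(in_upper_half h _) -mulnA in_upper_half_rep // addbC.
Qed.

Lemma gauss_modl h a b : a = b %[mod h.*2.+1] -> gauss_sign a h = gauss_sign b h.
Proof.
by move=> E; apply: eq_bigr => k _; rewrite -[in LHS]modnMml E modnMml.
Qed.

Lemma gauss_sqr h x a : coprime x h.*2.+1 -> a = x ^ 2 %[mod h.*2.+1] -> gauss_sign a h = false.
Proof. by move=> c /gauss_modl ->; rewrite gaussM // addbb. Qed.

Lemma gauss_sign_opp1 h : gauss_sign h.*2 h = odd h.
Proof.
rewrite /gauss_sign big_ord_recl muln0 mod0n ltn0 /=.
rewrite (eq_bigr (fun => true)).
  by rewrite big_const_ord; elim: h {1 2}h => [|h IH] h0 //=; rewrite IH.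
move=> i _; rewrite /bump /= add1n; have ih := ltn_ord i.
have -> : h.*2 * i.+1 = i * h.*2.+1 + (h.*2 - i) by nia.
rewrite modnMDl modn_small; lia.
Qed.

Lemma odd_big (I : finType) (F : I -> nat) : odd (\sum_i F i) = \big[addb/false]_i odd (F i).
Proof. exact: (big_morph odd oddD). Qed.

Lemma gauss_count h a : 0 < a -> coprime a h.*2.+1 ->
  gauss_sign a h = odd ((a - 1) * h + \sum_(i < a) (i * h.*2.+1) %/ a.*2).
Proof.
move=> a0 co; set m := h.*2.+1.
have step1 : gauss_sign a h = odd (\sum_(k < h.+1) (2 * (a * k)) %/ m).
  rewrite odd_big; apply: eq_bigr => k _; rewrite -/m.
  have L : (a * k) %% m < m by rewrite ltn_pmod.
  have -> : 2 * (a * k) = (2 * (a * k %/ m)) * m + 2 * (a * k %% m).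
    by rewrite -mulnA -mulnDr -divn_eq.
  rewrite divnMDl // oddD oddM /=; move: (a * k %% m) L => r L.
  case: (ltnP h r) => H.
    have -> : 2 * r = 1 * m + (2 * r - m) by rewrite /m in L *; lia.
    by rewrite divnMDl // divn_small //; rewrite /m in L *; lia.
  by rewrite divn_small //; rewrite /m in L *; lia.
rewrite step1.
have cnt (k : 'I_h.+1) : (2 * (a * k)) %/ m = \sum_(i < a) ((0 < i) && (i * m <= 2 * (a * k)))%N.
  have L : (2 * (a * k)) %/ m < a.
    rewrite ltn_divLR //; have := ltn_ord k; rewrite /m; nia.
  rewrite -(big_mkord xpredT (fun i => ((0 < i) && (i * m <= 2 * (a * k))) : nat)).
  under eq_bigr do rewrite -leq_divRL //.
  move: (_ %/ m) L => q; elim: a {co a0 step1 k}  => // a IH qa.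
  rewrite big_nat_recr //=; case: (ltnP q a) => H; first by rewrite -IH //; lia.
  have -> : a = q by lia.
  case: q {IH qa H} => [|q]; first by rewrite big_nil.
  rewrite big_nat_recl //= (eq_big_nat _ _ (F2 := fun => 1)).
    by rewrite sum_nat_const_nat; lia.
  by move=> i /andP[_ L]; rewrite ltnW.
under eq_bigr do rewrite cnt.
rewrite exchange_big /=.
have cnt2 (i : 'I_a) : \sum_(k < h.+1) ((0 < i) && (i * m <= 2 * (a * k)))%N
    = (0 < i) * (h - (i * m) %/ a.*2).
  case: i => -[|i] Hi /=; first by rewrite big1.
  rewrite mul1n; set q := (i.+1 * m) %/ a.*2.
  have qh : q <= h by rewrite -ltnS ltn_divLR ?double_gt0 //; move: Hi; rewrite /m; nia.
  transitivity (\sum_(k < h.+1) (q < k)%N).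
    apply: eq_bigr => k _; congr nat_of_bool.
    rewrite ltn_divLR ?double_gt0 // ltn_neqAle.
    have -> : k * a.*2 = 2 * (a * k) by lia.
    case: eqP => //= E.
    have : a %| i.+1 * m by rewrite E; apply/dvdnP; exists (2 * k); lia.
    rewrite Gauss_dvdl // => /dvdn_leq -/(_ isT); lia.
  rewrite -(big_mkord xpredT (fun k => (q < k) : nat)) (big_cat_nat (n := q.+1)) //=.
  rewrite big_nat big1 ?add0n; last by move=> k /andP[_]; lia.
  rewrite (eq_big_nat _ _ (F2 := fun => 1)) ?sum_nat_const_nat; first lia.
  by move=> k /andP[-> _].
under eq_bigr do rewrite cnt2.
case: a a0 {co step1 cnt} cnt2 => // a _ _.
rewrite subn1 /= !big_ord_recl /= mul0n add0n div0n add0n.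
have E (i : 'I_a) : (0 < bump 0 i) * (h - bump 0 i * m %/ a.+1.*2) + bump 0 i * m %/ a.+1.*2 = h.
  have Hi := ltn_ord i; rewrite /bump /= add1n mul1n subnK // -ltnS ltn_divLR ?double_gt0 //.
  rewrite /m; nia.
have : \sum_(i < a) ((0 < bump 0 i) * (h - bump 0 i * m %/ a.+1.*2)) +
       \sum_(i < a) (bump 0 i * m %/ a.+1.*2) = a * h.
  by rewrite -big_split /= (eq_bigr _ (fun i _ => E i)) sum_nat_const card_ord.
by move=> <-; rewrite !oddD -addbA addbb addbF.
Qed.

Lemma gauss_period a h t : 0 < a -> coprime a h.*2.+1 ->
  gauss_sign a (h + t * a.*2) = gauss_sign a h.
Proof.
move=> a0 co; have E : (h + t * a.*2).*2.+1 = (4 * t) * a + h.*2.+1 by lia.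
have co' : coprime a (h + t * a.*2).*2.+1.
  by rewrite E /coprime gcdnMDl.
rewrite !gauss_count // E.
rewrite (eq_bigr (fun i : 'I_a => 2 * (i * t) + (i * h.*2.+1) %/ a.*2)); last first.
  move=> i _; have -> : i * (4 * t * a + h.*2.+1) = (2 * (i * t)) * a.*2 + i * h.*2.+1 by lia.
  by rewrite divnMDl // double_gt0.
rewrite big_split -big_distrr /= mulnDr !oddD !oddM /= ?odd_double ?andbF.
by rewrite !addbF addbb.
Qed.

Lemma coprime_opp a m m' t : m + m' = t * a -> coprime a m -> coprime a m'.
Proof.
move=> E; rewrite /coprime => /eqP <-; apply/eqP/gcdn_def.
- exact: dvdn_gcdl.
- by rewrite -(dvdn_addr _ (dvdn_gcdr a m)) E dvdn_mull // dvdn_gcdl.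
- move=> d da dm; rewrite dvdn_gcd da -(dvdn_addl _ dm) E dvdn_mull //.
Qed.

Lemma gauss_reflect a h h' t : coprime a h.*2.+1 -> h + h' + 1 = t * a.*2 ->
  gauss_sign a h = gauss_sign a h'.
Proof.
move=> co E; have a0 : 0 < a by case: a E {co} => //; lia.
have co' : coprime a h'.*2.+1 by apply: (@coprime_opp _ h.*2.+1 _ (4 * t)) => //; lia.
rewrite !gauss_count //; set S := \sum_(i < a) _; set S' := \sum_(i < a) _.
suff : S + S' + (a - 1) = 2 * \sum_(i < a) (i * t).
  move=> /(congr1 odd); rewrite !oddD !oddM /=.
  have /(congr1 odd) := E; rewrite !oddD oddM odd_double andbF /=.
  rewrite addbF addbb.
  by case: (odd (a - 1)); case: (odd h); case: (odd h'); case: (odd S); case: (odd S').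
have -> : a - 1 = \sum_(i < a) (0 < i).
  case: a a0 {co co' E S S'} => // a _.
  by rewrite big_ord_recl /= sum_nat_const card_ord; lia.
rewrite -!big_split big_distrr /=; apply: eq_bigr => -[[|i] Hi] _ /=;
  first by rewrite !mul0n !div0n.
have nd : ~~ (a.*2 %| i.+1 * h.*2.+1).
  apply/negP => D; have : a %| i.+1 * h.*2.+1 by apply: dvdn_trans D; rewrite -muln2 dvdn_mulr.
  by rewrite Gauss_dvdl // => /dvdn_leq -/(_ isT); lia.
have a2 : 0 < a.*2 by rewrite double_gt0.
have EX : i.+1 * h.*2.+1 + i.+1 * h'.*2.+1 = 2 * (i.+1 * t) * a.*2 by nia.
have := ltn_pmod (i.+1 * h.*2.+1) a2; have := divn_eq (i.+1 * h.*2.+1) a.*2.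
move: nd; rewrite /dvdn -lt0n.
have -> : i.+1 * h'.*2.+1 = 2 * (i.+1 * t) * a.*2 - i.+1 * h.*2.+1 by lia.
have XT : i.+1 * h.*2.+1 <= 2 * (i.+1 * t) * a.*2 by lia.
move: XT => /[swap]; rewrite mulnA; move: (2 * i.+1 * t) => T.
move: ((i.+1 * h.*2.+1) %/ a.*2) ((i.+1 * h.*2.+1) %% a.*2) => q r.
move: (i.+1 * h.*2.+1) a.*2 a2 => X b b0 r0 + + rb.
move=> /[swap] -> XT.
have Tq : q < T by move: XT; nia.
have -> : T * b - (q * b + r) = (T - q - 1) * b + (b - r) by nia.
rewrite divnMDl // divn_small; lia.
Qed.

Definition is_sqr_mod (m : nat) (n : int) : Prop :=
  exists x y : int, (x ^+ 2 - n = m%:Z * y)%R.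

Lemma Fp_natr_eq p m n : prime p -> ((m%:R == n%:R :> 'F_p)%R) = (m == n %[mod p]).
Proof.
move=> pp; have pc := pchar_Fp pp.
wlog mn : m n / m <= n.
  by move=> W; case/orP: (leq_total m n) => L; [| rewrite eq_sym [RHS]eq_sym]; apply: W.
rewrite [RHS]eq_sym eqn_mod_dvd // (dvdn_pcharf pc) natrB // subr_eq0 eq_sym //.
Qed.

Local Open Scope ring_scope.

Lemma eqmodn_int p m n : m = n %[mod p] -> exists y : int, m%:Z - n%:Z = p%:Z * y.
Proof.
move=> E; exists ((m %/ p)%N%:Z - (n %/ p)%N%:Z).
rewrite [in LHS](divn_eq m p) [in LHS](divn_eq n p) E !PoszD !PoszM; ring.
Qed.

Lemma gauss_prime_power h a : prime h.*2.+1 -> coprime a h.*2.+1 ->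
  a%:R ^+ h = (-1) ^+ gauss_sign a h :> 'F_(h.*2.+1).
Proof.
set p := h.*2.+1 => pp co; have pc := pchar_Fp pp.
pose P := \prod_(k < h.+1 | k != ord0) (nat_of_ord k)%:R : 'F_p.
have P0 : P != 0.
  apply/prodf_neq0 => k k0; rewrite -(dvdn_pcharf pc).
  apply/negP => /dvdn_leq H; have := ltn_ord k; move: k0 H.
  rewrite -val_eqE /= -lt0n => k0 /(_ k0); rewrite /p; lia.
have fE (k : nat) : (a * k)%:R = (-1) ^+ in_upper_half h (a * k) * (half_rep h (a * k))%:R :> 'F_p.
  have E : ((a * k) %% p)%:R = (a * k)%:R :> 'F_p by apply/eqP; rewrite Fp_natr_eq // modn_mod.
  rewrite /half_rep; case: (in_upper_half h _); rewrite ?expr1 ?expr0 ?mul1r // natrB; last first.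
    by rewrite ltnW // ltn_pmod.
  by rewrite -/p (eqP (_ : p%:R == 0)) -?(dvdn_pcharf pc) // sub0r mulN1r opprK E.
apply: (mulIf P0).
transitivity (\prod_(k < h.+1 | k != ord0) (a * k)%:R : 'F_p).
  rewrite (eq_bigr (fun k : 'I_h.+1 => a%:R * (nat_of_ord k)%:R)); last first.
    by move=> k _; rewrite natrM.
  rewrite big_split prodr_const /=; congr (_ ^+ _ * _).
  by rewrite cardC1 card_ord.
rewrite (eq_bigr (fun k : 'I_h.+1 => (-1) ^+ in_upper_half h (a * k) * (half_rep h (a * k))%:R));
  last first.
  by move=> k _; exact: fE.
rewrite big_split /=; congr (_ * _).
  rewrite /gauss_sign (big_morph (id1 := 1) (op1 := *%R) (fun b : bool => (-1) ^+ b : 'F_p)) //;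
    last exact: signr_addb.
  rewrite [RHS](bigD1 ord0) //= -[(h < _)%N]/(in_upper_half h _) muln0 /in_upper_half mod0n ltn0 expr0 mul1r.
  by apply: eq_bigr.
rewrite /P [RHS](reindex_inj (half_rep_inj co)) /=; apply: eq_bigl => k.
have f0 : Ordinal (half_rep_lt h (a * (ord0 : 'I_h.+1))) = ord0.
  by apply: val_inj; rewrite /= /half_rep muln0 /in_upper_half mod0n ltn0.
by rewrite -{2}f0 (inj_eq (half_rep_inj co)).
Qed.

Lemma gauss_prime h a : prime h.*2.+1 -> coprime a h.*2.+1 ->
  ~ is_sqr_mod h.*2.+1 a -> gauss_sign a h.
Proof.
set p := h.*2.+1 => pp co nr; have pc := pchar_Fp pp.
apply/negPn/negP => /negPf G; have := gauss_prime_power pp co; rewrite G expr0 -/p => ah.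
have h0 : (0 < h)%N by rewrite lt0n; apply/eqP => E; move: pp; rewrite /p E.
pose rs := (a%:R : 'F_p) :: [seq (k%:R : 'F_p) ^+ 2 | k <- iota 1 h].
have : (size rs < size ('X^h - 1 : {poly 'F_p})%R)%N.
  apply: max_poly_roots.
  - by rewrite -size_poly_eq0 size_XnsubC.
  - apply/allP => x; rewrite inE => /orP[/eqP ->|/mapP[k]].
      by rewrite /root !hornerE ?hornerXn ah subrr.
    rewrite mem_iota => /andP[k1 kh] ->.
    rewrite /root !hornerE ?hornerXn -exprM.
    have k0 : (k%:R : 'F_p) != 0.
      rewrite -(dvdn_pcharf pc); apply/negP => /dvdn_leq -/(_ k1); rewrite /p; lia.
    rewrite subr_eq0; apply/eqP/(mulfI k0); rewrite -exprS mulr1 mul2n.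
    have := expf_card (k%:R : 'F_p); rewrite card_Fp //.
  - rewrite /= map_inj_in_uniq ?iota_uniq ?andbT.
      apply/negP => /mapP[k _ /eqP]; rewrite -natrX Fp_natr_eq // => E; apply: nr.
      have [y Ey] := eqmodn_int (eqP E); exists k%:Z, (- y).
      have -> : k%:Z ^+ 2 = (k ^ 2)%N%:Z by rewrite -!natz natrX.
      by rewrite mulrN -Ey opprB.
    move=> i j; rewrite !mem_iota => /andP[i1 ih] /andP[j1 jh] /eqP.
    rewrite -subr_eq0 subr_sqr mulf_eq0 subr_eq0 Fp_natr_eq // -natrD -(dvdn_pcharf pc).
    case/orP; first by rewrite !modn_small; rewrite /p; try lia; move/eqP.
    by move/dvdn_leq => H; have := H (ltn_addr _ i1); rewrite /p; lia.
by rewrite size_XnsubC //= size_map size_iota ltnn.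
Qed.

Lemma exists_nonresidue q : prime q -> odd q ->
  exists2 c : nat, coprime c q & ~ is_sqr_mod q c.
Proof.
move=> pq oq; have pc := pchar_Fp pq.
have [s|ns] := EM (forall x : 'F_q, exists y, y ^+ 2 = x).
  have : #|[set y ^+ 2 | y in [set: 'F_q]]%SET| == #|[set: 'F_q]%SET|.
    apply/eqP; congr #|pred_of_set _|; apply/setP => x; rewrite inE.
    by apply/imsetP; have [y <-] := s x; exists y.
  move=> /imset_injP inj; have := inj 1 (-1) (finset.in_setT _) (finset.in_setT _).
  rewrite sqrrN => /(_ erefl)/eqP; rewrite -subr_eq0 opprK -mulr2n.
  rewrite -(dvdn_pcharf pc) => /dvdn_leq -/(_ isT); case: (q) pq oq => [|[|[|]]] //.
move: ns => /existsNP[x nx]; exists (val x).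
  rewrite coprime_sym prime_coprime //; apply/negP => D; apply: nx; exists 0.
  rewrite expr0n /=; apply/eqP; rewrite eq_sym -[x]natr_Zp -(dvdn_pcharf pc) //.
move=> [y [z E]]; apply: nx; exists y%:~R.
rewrite -[RHS]natr_Zp [RHS]pmulrn; apply/eqP; rewrite -subr_eq0 -rmorphXn -rmorphB /= E.
by rewrite rmorphM /= -[(q%:~R)%R]pmulrn (eqP (_ : q%:R == 0)) ?mul0r // -(dvdn_pcharf pc).
Qed.

Local Close Scope ring_scope.

Lemma is_sqr_mod_congr (m : nat) (n n' z : int) : (n - n' =
  m%:Z * z)%R -> is_sqr_mod m n' -> is_sqr_mod m n.
Proof.
move=> E [x [y H]]; exists x, (y - z)%R; rewrite mulrBr -H -E; ring.
Qed.

Lemma bezout_int (m n : nat) : coprime m n -> exists u v : int, (m%:Z * u + n%:Z * v = 1)%R.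
Proof.
move=> co; have [u [v E]] := Bezoutz m n; exists u, v.
by rewrite ![(Posz _ * _)%R]mulrC E /gcdz /= (eqP co).
Qed.

Lemma is_sqr_mod_composite (m : nat) (n : int) : odd m -> coprime m `|n| ->
  (forall p, prime p -> p %| m -> is_sqr_mod p n) -> is_sqr_mod m n.
Proof.
elim/ltn_ind: m => m IH om co H.
case: (ltnP 1 m) => m1; last first.
  have -> : m = 1 by case: (m) m1 om => [|[]].
  by exists 0%R, (- n)%R; rewrite expr0n /= mul1r sub0r.
pose p := pdiv m; have pp : prime p := pdiv_prime m1.
have [m' Em] : exists m', m = m' * p by apply/dvdnP/pdiv_dvd.
have p1 := prime_gt1 pp.
have op : odd p by move: om; rewrite Em oddM => /andP[].
have pn : coprime p `|n| by move: co; rewrite Em coprimeMl => /andP[].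
have [x [t Ex]] : is_sqr_mod m' n.
  apply: IH.
  - by rewrite Em; move: (om); rewrite Em; case: (m') => // k _; nia.
  - by move: om; rewrite Em oddM => /andP[].
  - by move: co; rewrite Em coprimeMl => /andP[].
  - by move=> q pq qm; apply: H => //; rewrite Em dvdn_mulr.
case pm' : (p %| m'); last first.
  have cpm : coprime m' p by rewrite coprime_sym prime_coprime // pm'.
  have [y [w Ey]] := H p pp (pdiv_dvd m).
  have [u [v Euv]] := bezout_int cpm.
  pose z := (x + m'%:Z * u * (y - x))%R.
  have Ez : z = (y + p%:Z * v * (x - y))%R.
    apply/eqP; rewrite -subr_eq0 /z.
    rewrite (_ : _ - _ = (x - y) * (1 - (m'%:Z * u + p%:Z * v)))%R; last by ring.
    by rewrite Euv subrr mulr0.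
  exists z.
  have : ((m'%:Z * p%:Z)%R %| (z ^+ 2 - n)%R)%Z.
    rewrite Gauss_dvdz; last by rewrite /coprimez /gcdz /= (eqP cpm).
    apply/andP; split; apply/dvdzP.
      exists (t + 2 * x * (u * (y - x)) + m'%:Z * (u * (y - x)) ^+ 2)%R.
      by rewrite -[n](subKr (x^+2)) Ex /z; ring.
    exists (w + 2 * y * (v * (x - y)) + p%:Z * (v * (x - y)) ^+ 2)%R.
    by rewrite -[n](subKr (y^+2)) Ey Ez; ring.
  by move=> /dvdzP[k Ek]; exists k; rewrite Ek Em PoszM mulrC.
have [m2 Em2] := dvdnP pm'.
have cx : coprime (2 * `|x|) p.
  rewrite coprimeMl coprime2n op /= coprime_sym prime_coprime //.
  apply/negP => D; move: pn; rewrite prime_coprime // => /negP; apply.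
  have [k Ek] := dvdzP (D : (p %| x)%Z).
  suff : (p %| n)%Z by [].
  apply/dvdzP; exists (k * x - m2%:Z * t)%R; move: Ex; rewrite expr2 {1}Ek Em2 PoszM.
  by rewrite mulrBl => E; rewrite -[n](subKr (k * p * x)%R) E; ring.
have [u0 [v Euv0]] := bezout_int cx.
have [u Euv] : exists u, (2 * x * u + p%:Z * v = 1)%R.
  exists ((-1) ^+ (x < 0)%R * u0)%R; rewrite -[RHS]Euv0 PoszM abszEsign; ring.
exists (x - m'%:Z * t * u)%R, (t * v + m2%:Z * (t * u) ^+ 2)%R.
rewrite -[n](subKr (x^+2)) Ex Em PoszM.
have -> : (m'%:Z * p%:Z * (t * v + m2%:Z * (t * u) ^+ 2) =
  m'%:Z * (t * (p%:Z * v)) + m'%:Z * (m2 * p)%N%:Z * (t * u) ^+ 2)%R by rewrite PoszM; ring.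
rewrite -Em2 (_ : (p%:Z * v)%R = (1 - 2 * x * u)%R); first by ring.
by apply/eqP; rewrite eq_sym subr_eq addrC Euv.
Qed.

Lemma gauss_sq a h : coprime a h.*2.+1 -> gauss_sign (a ^ 2) h = false.
Proof. by move=> c; rewrite gaussM // addbb. Qed.

Lemma gauss_sign_sqr_mod (a h : nat) : coprime a h.*2.+1 -> is_sqr_mod h.*2.+1 a -> gauss_sign a h = false.
Proof.
set m := h.*2.+1 => co [x [y E]].
pose k := `|(x %% m)%Z|%N.
have Ek : Posz k = (x %% m)%Z by rewrite /k gez0_abs ?modz_ge0.
have {}E : a = k ^ 2 %[mod m].
  apply/eqP; rewrite -eqz_nat -!modz_nat eq_sym -[Posz (k ^ 2)]natz natrX natz Ek modzXm.
  by rewrite eqz_mod_dvd E dvdz_mulr.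
apply: gauss_sqr (E); rewrite -/m -(@coprime_pexpl 2) // -coprime_modl -E coprime_modl //.
Qed.

(* The factor h.*2 stands for -1 modulo h.*2.+1. *)
Lemma gaussN a h : coprime a h.*2.+1 -> gauss_sign (a * h.*2) h = gauss_sign a h (+) odd h.
Proof. by move=> co; rewrite gaussM ?gauss_sign_opp1 // coprime_sym coprimeSn. Qed.

Lemma coprime_exp2 k m : odd m -> coprime (2 ^ k) m.
Proof. by move=> om; rewrite coprimeXl // coprime2n. Qed.

Lemma gauss4 a h : coprime a h.*2.+1 -> gauss_sign (4 * a) h = gauss_sign a h.
Proof.
move=> co; have c4 : coprime (2 ^ 2) h.*2.+1 by rewrite coprime_pexpl // coprime2n /= odd_double.
by rewrite -[4]/(2 ^ 2) gaussM // gauss_sq // coprime2n /= odd_double.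
Qed.

Lemma gauss_reciprocity h g : coprime h.*2.+1 g.*2.+1 -> ~~ odd h -> g < h ->
  gauss_sign g.*2.+1 h = gauss_sign h.*2.+1 g.
Proof.
move=> co oh gh; set m := h.*2.+1; set q := g.*2.+1.
case og : (odd g).
  have [a Ea] : exists a, m + q = 4 * a by exists (h + g).+1./2; rewrite /m /q; lia.
  have : coprime m (m + q) by rewrite /coprime gcdnDl.
  rewrite Ea coprimeMr coprime_sym (coprime_sym m) => /andP[_ cam].
  have caq : coprime a q by apply: (@coprime_opp _ m _ 4).
  rewrite (@gauss_modl _ q (4 * a)) -?Ea ?modnDl // Ea gauss4 //.
  have -> : gauss_sign m g = gauss_sign (4 * a) g by apply: gauss_modl; rewrite -Ea modnDr.
  rewrite gauss4 //.
  by apply: (@gauss_reflect _ _ _ 1) => //; move: Ea; rewrite /m /q; lia.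
have [a Ea] : exists a, m = q + 4 * a by exists (h - g)./2; rewrite /m /q; lia.
have : coprime q m by rewrite coprime_sym.
rewrite Ea /coprime gcdnDl -/(coprime _ _) coprimeMr coprime_sym (coprime_sym q) => /andP[_ caq].
have cam : coprime a m by rewrite Ea /coprime addnC gcdnMDl.
have c4am : coprime (4 * a) m by rewrite coprimeMl cam (coprime_exp2 2) //= odd_double.
have a0 : 0 < a by move: Ea; rewrite /m /q; case: (a) => //; lia.
rewrite (@gauss_modl _ q (4 * a * h.*2)).
  rewrite gaussN // (negPf oh) addbF gauss4 //.
  have -> : gauss_sign (q + 4 * a) g = gauss_sign (4 * a) g by apply: gauss_modl; rewrite modnDl.
  rewrite gauss4 //.
  have -> : h = g + 1 * a.*2 by move: Ea; rewrite /m /q; lia.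
  by rewrite gauss_period.
apply/eqP; rewrite -(eqn_modDr (4 * a)) -Ea -mulnSr -/m modnn modnMl //.
Qed.

Lemma odd_logn_nonsquare n : 0 < n -> ~ (exists s, n = s ^ 2) ->
  exists2 q, prime q & odd (logn q n).
Proof.
move=> n0 ns; case E : (has (fun q => odd (logn q n)) (primes n)).
  have [q + o] := hasP E; rewrite mem_primes => /and3P[pq _ _]; by exists q.
case: ns; exists (\prod_(q <- primes n) q ^ (logn q n)./2).
rewrite {1}(prod_prime_decomp n0) prime_decompE big_map /=.
rewrite (big_morph (fun x => x ^ 2) (fun x y => expnMn x y 2) (exp1n 2)).
rewrite !big_seq; apply: eq_bigr => q qn; rewrite -expnM muln2; congr (_ ^ _).
have /hasPn/(_ _ qn) := negbT E; move: (logn q n) => l /=; lia.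
Qed.

Lemma gauss_sign_odd_exp h q l : coprime q h.*2.+1 -> odd l -> gauss_sign (q ^ l) h =
  gauss_sign q h.
Proof.
move=> co ol; rewrite -(odd_double_half l) ol expnD expn1 gaussM //; last exact: coprimeXl.
by rewrite -muln2 expnM gauss_sq ?addbF // coprimeXl.
Qed.

Lemma gauss_mod1 n h t : 0 < n -> h.*2.+1 = 4 * n * t + 1 -> gauss_sign n h = false.
Proof.
move=> n0 E; have -> : h = 0 + t * n.*2 by lia.
by rewrite gauss_period ?coprimen1 // /gauss_sign big_ord_recl big_ord0 modn1.
Qed.

Lemma nonsquare_gauss_sign n : 0 < n -> ~ (exists s, n = s ^ 2) ->
  exists h, coprime n h.*2.+1 /\ gauss_sign n h.
Proof.
move=> n0 /(odd_logn_nonsquare n0)[q pq ol].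
have [n' cq En] := pfactor_coprime pq n0; set l := logn q n in ol En.
have n'0 : 0 < n' by case: (n') En n0 => // ->.
have q0 := prime_gt0 pq.
have [q2|q2] := eqVneq q 2.
  have on' : odd n' by rewrite q2 coprime2n in cq.
  have c8 : coprime 8 n' by exact: (coprime_exp2 3).
  pose m := chinese 8 n' 5 1.
  have m8 : m = 5 %[mod 8] by rewrite chinese_modl.
  have mn' : m = 1 %[mod n'] by rewrite chinese_modr.
  have om : odd m by lia.
  have Em : m = (m./2).*2.+1 by lia.
  exists m./2; rewrite -Em.
  have c2 : coprime 2 m by rewrite coprime2n.
  have cn' : coprime n' m by rewrite coprime_sym -coprime_modl mn' coprime_modl coprime1n.
  have [t Et] : exists t, m./2.*2.+1 = 4 * n' * t + 1.
    have m0 : 0 < m by lia.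
    have : 4 * n' %| m - 1.
      rewrite Gauss_dvd; last exact: (coprime_exp2 2).
      apply/andP; split; last by rewrite -eqn_mod_dvd //; apply/eqP.
      by apply/dvdnP; exists ((m %/ 8) * 2 + 1); lia.
    by move=> /dvdnP[t Et]; exists t; lia.
  have cqm : coprime q m by rewrite q2.
  rewrite En coprimeMl cn' coprimeXl //; split=> //.
  rewrite gaussM -?Em ?coprimeXl // (gauss_mod1 n'0 Et) /=.
  rewrite gauss_sign_odd_exp -?Em // q2.
  have -> : m./2 = 2 + (m %/ 8) * 2.*2 by lia.
  by rewrite gauss_period // /gauss_sign !big_ord_recl big_ord0.
have oq : odd q by apply: contraNT q2 => /(prime_oddPn pq) ->.
have [c cc nc] := exists_nonresidue pq oq.
have c4q : coprime q (4 * n') by rewrite coprimeMr cq andbT coprime_sym (coprime_exp2 2).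
pose m := chinese q (4 * n') c 1 + 4 * n' * q.
have mq : m = c %[mod q] by rewrite /m addnC modnMDl chinese_modl.
have m4 : m = 1 %[mod 4 * n'].
  by rewrite /m addnC (mulnC (4 * n')) modnMDl chinese_modr.
have mgt : q < m by rewrite /m; nia.
have [t Et] : exists t, m = 4 * n' * t + 1.
  have : 4 * n' %| m - 1 by rewrite -eqn_mod_dvd ?m4 //; apply: leq_ltn_trans mgt.
  by move=> /dvdnP[t Et]; exists t; lia.
have om : odd m by rewrite Et oddD !oddM.
have Em : m = (m./2).*2.+1 by lia.
have Eq : q = (q./2).*2.+1 by lia.
exists m./2; rewrite -Em.
have cn' : coprime n' m by rewrite Et mulnAC /coprime gcdnMDl gcdn1.
have cqm : coprime q m by rewrite coprime_sym -coprime_modl mq coprime_modl.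
rewrite En coprimeMl cn' coprimeXl //; split=> //.
rewrite gaussM -?Em ?coprimeXl // (@gauss_mod1 _ _ t) -?Em //=.
rewrite gauss_sign_odd_exp -?Em // Eq gauss_reciprocity -?Em -?Eq //; first last.
- lia.
- by rewrite Et; apply/negP; lia.
- by rewrite coprime_sym.
by rewrite (@gauss_modl _ _ c) -?Eq // gauss_prime -?Eq.
Qed.

Lemma square_of_local_squares n : 0 < n ->
  (forall p, prime p -> odd p -> coprime p n -> is_sqr_mod p n) -> exists s, n = s ^ 2.
Proof.
move=> n0 H; apply: contrapT => /(nonsquare_gauss_sign n0)[h [co]].
rewrite gauss_sign_sqr_mod //; apply: is_sqr_mod_composite; rewrite /= ?odd_double //.
  by rewrite coprime_sym.
move=> p pp pm; apply: H => //.
- by have := dvdn_odd pm; rewrite /= odd_double; apply.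
- by rewrite coprime_sym; apply: coprime_dvdr co.
Qed.

Lemma is_sqr_mod_periodic (d a p : nat) : 0 < d -> prime p -> odd p -> odd a ->
  coprime d a -> coprime d p ->
  p = a %[mod 4 * d] -> is_sqr_mod a (- d%:Z)%R -> is_sqr_mod p (- d%:Z)%R.
Proof.
move=> d0 pp op oa cda cdp E Ra; apply: contrapT => Rp.
have Ep : p = (p./2).*2.+1 by lia.
have Ea : a = (a./2).*2.+1 by lia.
have neg (m : nat) : odd m -> exists z, (- d%:Z - (d * (m./2).*2)%N%:Z = m%:Z * z)%R.
  move=> om; exists (- d%:Z)%R.
  have Em : m = (m./2).*2.+1 by lia.
  by rewrite {2}Em PoszM -addn1 PoszD; ring.
have G : gauss_sign (d * (p./2).*2) p./2.
  apply: gauss_prime; rewrite -?Ep //.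
    by rewrite coprimeMl cdp /= {2}Ep coprimenS.
  move=> R; apply: Rp; have [z Ez] := neg p op; exact: is_sqr_mod_congr Ez R.
have G' : gauss_sign (d * (a./2).*2) a./2 = false.
  apply: gauss_sign_sqr_mod; rewrite -?Ea //.
    by rewrite coprimeMl cda /= {2}Ea coprimenS.
  have [z Ez] := neg a oa; apply: (@is_sqr_mod_congr _ _ _ (- z)%R) Ra.
  by rewrite mulrN -Ez opprB.
move: G; rewrite gaussN -?Ep //; move: G'; rewrite gaussN -?Ea //.
suff [-> ->] : gauss_sign d a./2 = gauss_sign d p./2 /\ odd a./2 = odd p./2 by move=> ->.
have W (x y : nat) : x <= y -> odd x -> odd y -> coprime d x -> x = y %[mod 4 * d] ->
  gauss_sign d x./2 = gauss_sign d y./2 /\ odd x./2 = odd y./2.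
  move=> xy ox oy cx /eqP; rewrite eq_sym eqn_mod_dvd // => /dvdnP[k Ek].
  have -> : y./2 = x./2 + k * d.*2 by nia.
  rewrite gauss_period //; last by have -> : (x./2).*2.+1 = x by lia.
  by split=> //; rewrite oddD oddM odd_double andbF addbF.
by case: (leqP a p) => L; [|have [] := W p a (ltnW L) op oa cdp E; split]; try exact: W.
Qed.

Local Open Scope ring_scope.
Local Open Scope quotient_scope.

(** * The profinite integers *)

Lemma zhat_val_inj (x y : Zhat) : (forall k, x k = y k :> nat) -> x = y.
Proof. by move=> E; apply: zhatP => k; apply/val_inj/E. Qed.

Lemma zhat_valD (x y : Zhat) k : (x + y) k = ((x k + y k) %% k.+2)%N :> nat.
Proof. by []. Qed.

Lemma zhat_valM (x y : Zhat) k : (x * y) k = ((x k * y k) %% k.+2)%N :> nat.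
Proof. by []. Qed.

Lemma zhat_val0 k : (0 : Zhat) k = 0%N :> nat.
Proof. by []. Qed.

Lemma zhat_val_nat n k : (n%:R : Zhat) k = (n %% k.+2)%N :> nat.
Proof.
elim: n => [|n IH]; first by rewrite mod0n.
by rewrite -(addn1 n) natrD zhat_valD IH modnDml modnDmr.
Qed.

Lemma zhat_val_dvd (x : Zhat) m n : (m.+2 %| n.+2)%N -> x m = (x n %% m.+2)%N :> nat.
Proof. by move=> d; rewrite (zres_compatible x d). Qed.

Definition scale_index (N k : nat) : nat := (N * k.+2).-2.

Lemma scale_indexE N k : (0 < N)%N -> (scale_index N k).+2 = (N * k.+2)%N.
Proof. by rewrite /scale_index; case: N => // N _; rewrite mulSn. Qed.

Lemma zhat_quot_compatible (N : nat) (N0 : (0 < N)%N) (x : Zhat) :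
  zhat_compatible (fun k => inZp (x (scale_index N k) %/ N)).
Proof.
move=> m n mn; rewrite inZp_inZp //; apply: val_inj => /=.
have d : ((scale_index N m).+2 %| (scale_index N n).+2)%N.
  by rewrite !scale_indexE // dvdn_pmul2l.
rewrite (zhat_val_dvd x d); move: (nat_of_ord _) => v; rewrite scale_indexE //.
rewrite {2}(divn_eq v (N * m.+2)) [(N * _)%N]mulnC mulnA divnMDl // modnMDl //.
Qed.

Lemma zhat_euclid (N : nat) (x : Zhat) : (0 < N)%N ->
  exists r y, (r < N)%N /\ x = r%:R + N%:R * y.
Proof.
move=> N0; pose r := (x (scale_index N 0) %% N)%N.
have rE k : r = (x (scale_index N k) %% N)%N.
  rewrite /r; case: (N) N0 => // -[|n] _; first by rewrite !modn1.
  by rewrite -!(@zhat_val_dvd x n) // scale_indexE // dvdn_mulr.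
exists r, (MkZhat (zhat_quot_compatible N0 x)); split; first by rewrite ltn_pmod.
apply: zhat_val_inj => k; rewrite zhat_valD zhat_valM !zhat_val_nat /=.
rewrite modnDm -modnDmr modnMm modnDmr (rE k).
by rewrite addnC mulnC -divn_eq -zhat_val_dvd // scale_indexE // dvdn_mull.
Qed.

Lemma zhat_natr_inj (n : nat) (x : Zhat) : (0 < n)%N -> n%:R * x = 0 -> x = 0.
Proof.
move=> n0 E; apply: zhat_val_inj => k.
have d : (k.+2 %| (scale_index n k).+2)%N by rewrite scale_indexE // dvdn_mull.
rewrite (zhat_val_dvd x d) zhat_val0; apply/eqP.
have /(congr1 (fun z : Zhat => nat_of_ord (z (scale_index n k)))) := E.
rewrite zhat_valM zhat_val_nat zhat_val0 modnMml.
move: (nat_of_ord _) => v; rewrite scale_indexE // => /eqP.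
by rewrite -/(dvdn _ _) dvdn_pmul2l.
Qed.

Lemma zhat_natr_dvd (n m : nat) (x : Zhat) : (0 < n)%N -> n%:R * x = m%:R -> (n %| m)%N.
Proof.
case: n => // -[|n] _; first by rewrite dvd1n.
move=> /(congr1 (fun z : Zhat => nat_of_ord (z n))).
by rewrite zhat_valM !zhat_val_nat modnn mod0n /dvdn => <-.
Qed.

Lemma toZhatD : {morph toZhat : x y / x + y}. Proof. exact: rmorphD. Qed.
Lemma toZhatM : {morph toZhat : x y / x * y}. Proof. exact: rmorphM. Qed.
Lemma toZhatN : {morph toZhat : x / - x}. Proof. exact: rmorphN. Qed.
Lemma toZhat_nat (n : nat) : toZhat n = n%:R. Proof. by rewrite /toZhat -pmulrn. Qed.
Lemma toZhat0 : toZhat 0 = 0. Proof. by []. Qed.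
Lemma toZhat1 : toZhat 1 = 1. Proof. by []. Qed.

Lemma toZhat_sign (n : int) : exists2 s : Zhat, s * s = 1 & toZhat n = s * `|n|%N%:R.
Proof.
exists ((-1) ^+ (n < 0)%R); first by rewrite -expr2 sqrr_sign.
by rewrite -toZhat_nat {1}[n]intEsign toZhatM /toZhat rmorph_sign.
Qed.

Lemma toZhat_reg (n : int) (x : Zhat) : n != 0 -> toZhat n * x = 0 -> x = 0.
Proof.
move=> n0; have [s ss ->] := toZhat_sign n => E.
apply: (@zhat_natr_inj `|n|%N); first by rewrite absz_gt0.
have -> : `|n|%N%:R * x = s * (s * `|n|%N%:R * x) by rewrite !mulrA ss mul1r.
by rewrite E mulr0.
Qed.

Lemma toZhat_lreg (n : int) : n != 0 -> injective ( *%R (toZhat n)).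
Proof.
move=> n0 x y /eqP; rewrite -subr_eq0 -mulrBr => /eqP/(toZhat_reg n0)/eqP.
by rewrite subr_eq0 => /eqP.
Qed.

Lemma toZhat_eq0 (n : int) : toZhat n = 0 -> n = 0.
Proof.
move=> E; apply: contrapT => /eqP n0; have := oner_neq0 Zhat; apply/negP/negPn/eqP.
by apply: (toZhat_reg n0); rewrite E mul0r.
Qed.

Lemma toZhat_dvd (n m : int) (x : Zhat) : toZhat n * x = toZhat m -> (n %| m)%Z.
Proof.
have [->|n0] := eqVneq n 0.
  by rewrite toZhat0 mul0r => /esym/toZhat_eq0 ->.
have [s ss ->] := toZhat_sign n; have [t tt ->] := toZhat_sign m => E.
rewrite /dvdz; apply: (@zhat_natr_dvd _ _ (t * s * x)); first by rewrite absz_gt0.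
have -> : `|n|%N%:R * (t * s * x) = t * (s * `|n|%N%:R * x) by ring.
by rewrite E mulrA tt mul1r.
Qed.

Lemma zhat_separated (x : Zhat) : (forall N, (0 < N)%N -> exists y, x = N%:R * y) -> x = 0.
Proof.
move=> H; apply: zhat_val_inj => k; have [y ->] := H k.+2 isT.
by rewrite zhat_valM zhat_val_nat modnn mod0n zhat_val0.
Qed.

Lemma zhat_additive_linear (phi : Zhat -> Zhat) : {morph phi : x y / x + y} ->
  forall x, phi x = x * phi 1.
Proof.
move=> phiD; have phin (n : nat) x : phi (n%:R * x) = n%:R * phi x.
  elim: n => [|n IH]; last by rewrite -(addn1 n) natrD !mulrDl phiD IH !mul1r.
  by rewrite !mul0r; apply: (addIr (phi 0)); rewrite -phiD !add0r.
move=> x; apply/eqP; rewrite -subr_eq0; apply/eqP/zhat_separated => N N0.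
have [r [y [_ ->]]] := zhat_euclid x N0.
have phir : phi r%:R = r%:R * phi 1 by rewrite -phin mulr1.
exists (phi y - y * phi 1); rewrite phiD phin phir; ring.
Qed.

Lemma zhat_unit_criterion (x : Zhat) :
  (forall p, prime p -> ~ exists y, x = p%:R * y) -> x \is a GRing.unit.
Proof.
move=> H; have co k : coprime k.+2 (x k).
  rewrite /coprime; apply: contrapT => /eqP g1.
  have xk0 : (gcdn k.+2 (x k) > 1)%N.
    by move: g1; case: (gcdn _ _) (gcdn_gt0 k.+2 (x k)) => [|[|]].
  have pp := pdiv_prime xk0; apply: (H _ pp); have := pdiv_dvd (gcdn k.+2 (x k)).
  move: (pdiv _) pp => p pp pg; have p1 := prime_gt1 pp.
  have [r [y [rp E]]] := zhat_euclid x (prime_gt0 pp); exists y.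
  suff r0 : r = 0%N by rewrite {1}E r0 add0r.
  have pk : ((p.-2).+2 %| k.+2)%N by case: (p) p1 (dvdn_trans pg (dvdn_gcdl _ _)) => [|[]].
  have := zhat_val_dvd x pk; have -> : (x k %% p.-2.+2 = 0)%N.
    by apply/eqP; case: (p) p1 (dvdn_trans pg (dvdn_gcdr _ _)) => [|[]].
  rewrite E zhat_valD zhat_valM !zhat_val_nat; move: (nat_of_ord _) => w.
  have -> : p.-2.+2 = p by case: (p) p1 => [|[]].
  by rewrite modnn mul0n mod0n addn0 modn_mod modn_small.
have U k : x k \is a GRing.unit.
  by have := unitZpE (x k) (isT : (1 < k.+2)%N); rewrite co natr_Zp.
have C : zhat_compatible (fun k => (x k)^-1).
  move=> m n mn; apply: (mulrI (U m)); rewrite (mulrV (U m)).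
  have := mulrV (U n) => /(congr1 val) /= E.
  apply: val_inj => /=; rewrite (zhat_val_dvd x mn) modnMml modnMmr.
  by move: E => /(congr1 (modn^~ m.+2)); rewrite modn_dvdm // => ->.
apply/unitrP; exists (MkZhat C); split; apply: zhatP => k;
  [exact: (mulVr (U k))|exact: (mulrV (U k))].
Qed.

Lemma eqn_mod_partC (p k a b : nat) :
  (a == b %[mod k.+2])%N = (a == b %[mod (k.+2)`_p])%N && (a == b %[mod (k.+2)`_p^'])%N.
Proof. by rewrite -chinese_remainder ?coprime_partC // partnC. Qed.

Lemma zhat_idem_compatible (p : nat) : zhat_compatible
  (fun k => inZp (chinese (k.+2)`_p (k.+2)`_p^' 1 0)).
Proof.
move=> m n mn; rewrite inZp_inZp //; apply: val_inj => /=; apply/eqP.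
have co k : coprime (k.+2)`_p (k.+2)`_p^' by exact: coprime_partC.
have dp : ((m.+2)`_p %| (n.+2)`_p)%N by apply: partn_dvd.
have dp' : ((m.+2)`_p^' %| (n.+2)`_p^')%N by apply: partn_dvd.
rewrite (eqn_mod_partC p) !chinese_modl // !chinese_modr //.
have /(congr1 (modn^~ (m.+2)`_p)%N) := chinese_modl (co n) 1 0.
have /(congr1 (modn^~ (m.+2)`_p^')%N) := chinese_modr (co n) 1 0.
by rewrite !modn_dvdm // => -> ->; rewrite !eqxx.
Qed.

Definition zhat_idem p := MkZhat (zhat_idem_compatible p).

Lemma zhat_idem_idem p : zhat_idem p * zhat_idem p = zhat_idem p.
Proof.
apply: zhat_val_inj => k; rewrite zhat_valM /= modnMm; apply/eqP.
set e := chinese _ _ _ _.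
have co : coprime (k.+2)`_p (k.+2)`_p^' by exact: coprime_partC.
rewrite (eqn_mod_partC p).
rewrite -!(modnMm e e) !(chinese_modl co) !(chinese_modr co).
by rewrite !modnMm mul0n muln1 !eqxx.
Qed.

Lemma zhat_idem1 p : prime p -> exists y, zhat_idem p = 1 + p%:R * y.
Proof.
move=> pp; have p1 := prime_gt1 pp.
have [r [y [rp E]]] := zhat_euclid (zhat_idem p) (prime_gt0 pp); exists y.
rewrite {1}E; suff -> : r = 1%N by [].
have : zhat_idem p p.-2 = 1%N :> nat.
  rewrite /=; have -> : p.-2.+2 = p by case: (p) p1 => [|[]].
  have pn : p.-nat p by exact: pnat_id.
  have := chinese_modl (coprime_partC p p p) 1 0.
  by rewrite part_pnat_id // (modn_small p1) => ->.
rewrite {1}E zhat_valD zhat_valM !zhat_val_nat; move: (nat_of_ord _) => w.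
have -> : p.-2.+2 = p by case: (p) p1 => [|[]].
by rewrite modnn mul0n mod0n addn0 modn_mod modn_small.
Qed.

Lemma zhat_idem0 p (n : nat) : (0 < n)%N -> prime p -> coprime p n ->
  exists y, zhat_idem p = n%:R * y.
Proof.
case: n => // -[|n] _ pp co; first by exists (zhat_idem p); rewrite mul1r.
have [r [y [rp E]]] := zhat_euclid (zhat_idem p) (isT : (0 < n.+2)%N); exists y.
rewrite {1}E; suff -> : r = 0%N by rewrite add0r.
have : zhat_idem p n = 0%N :> nat.
  have pn : p^'.-nat n.+2 by rewrite p'natE // -prime_coprime.
  have := chinese_modr (coprime_partC p n.+2 n.+2) 1 0.
  by rewrite /= (part_pnat_id pn) mod0n => ->.
rewrite {1}E zhat_valD zhat_valM !zhat_val_nat; move: (nat_of_ord _) => w.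
by rewrite modnn mul0n mod0n addn0 modn_mod modn_small.
Qed.

(** * Ideal elements attached to framed forms *)

(* In this section the pair (x, y) stands for x + y sqrt d. *)
Section Pairs.
Variables (R : comNzRingType) (d : R).
Definition pmul (u v : R * R) : R * R := (u.1 * v.1 + d * u.2 * v.2, u.1 * v.2 + u.2 * v.1).
Definition pnorm (u : R * R) : R := u.1 ^+ 2 - d * u.2 ^+ 2.
Definition pconj (u : R * R) : R * R := (u.1, - u.2).

Lemma pmulC : commutative pmul.
Proof. by move=> [a b] [a' b']; congr pair => /=; ring. Qed.
Lemma pmulA : associative pmul.
Proof. by move=> [a b] [a' b'] [a2 b2]; congr pair => /=; ring. Qed.
Lemma pmulACA : interchange pmul pmul.
Proof. by move=> [a b] [a' b'] [a2 b2] [a3 b3]; congr pair => /=; ring. Qed.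
Lemma pmul1 : left_id (1, 0) pmul.
Proof. by move=> [a b]; congr pair => /=; ring. Qed.
Lemma pnormM u v : pnorm (pmul u v) = pnorm u * pnorm v.
Proof. by case: u v => [a b] [a' b']; rewrite /pnorm /=; ring. Qed.
Lemma pmul_conj u v : pmul (pconj u) (pmul u v) = (pnorm u * v.1, pnorm u * v.2).
Proof. by case: u v => [a b] [a' b']; congr pair; rewrite /pnorm /=; ring. Qed.
End Pairs.

Definition zpair (m : int * int) : Zhat * Zhat := (toZhat m.1, toZhat m.2).

Lemma zpairM D m n : zpair (pmul D m n) = pmul (toZhat D) (zpair m) (zpair n).
Proof. by rewrite /zpair /pmul /= !(toZhatM, toZhatD). Qed.

Lemma pnorm_gt0 (D : int) (m : int * int) : D < 0 -> m != 0 -> 0 < pnorm D m.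
Proof.
case: m => m n D0; rewrite -[0]/(0, 0) xpair_eqE /pnorm /= negb_and => H.
have [n0|n0] := eqVneq n 0.
  move: H; rewrite n0 eqxx orbF => m0; rewrite expr0n mulr0 subr0.
  by rewrite lt0r sqr_ge0 sqrf_eq0 m0.
have : 0 < n ^+ 2 by rewrite lt0r sqr_ge0 sqrf_eq0 n0.
have := sqr_ge0 m; nia.
Qed.

Definition proportional D (u v : Zhat * Zhat) : Prop :=
  exists m n : int * int, [/\ m != 0, n != 0
    & pmul (toZhat D) (zpair m) u = pmul (toZhat D) (zpair n) v].

Section Proportional.
Variables (D : int) (D0 : D < 0).
Local Notation "u ~~> v" := (proportional D u v) (at level 70).
Local Notation "u ** v" := (pmul (toZhat D) u v) (at level 40, left associativity).

Lemma pmul_neq0 m n : m != 0 -> n != 0 -> pmul D m n != 0.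
Proof.
move=> m0 n0; apply/eqP => E; have := pnormM D m n; rewrite E.
have := pnorm_gt0 D0 m0; have := pnorm_gt0 D0 n0; rewrite {3}/pnorm /=; nia.
Qed.

Lemma proportional_refl u : u ~~> u.
Proof. by exists (1, 0), (1, 0). Qed.

Lemma proportional_sym u v : u ~~> v -> v ~~> u.
Proof. by move=> [m [n [m0 n0 E]]]; exists n, m. Qed.

Lemma proportional_trans u v w : u ~~> v -> v ~~> w -> u ~~> w.
Proof.
move=> [m [n [m0 n0 E]]] [m' [n' [m0' n0' E']]].
exists (pmul D m' m), (pmul D n n'); split; try exact: pmul_neq0.
by rewrite !zpairM -!pmulA E -E' pmulA pmulA [zpair n ** _]pmulC.
Qed.

Lemma proportional_mul u u' v v' : u ~~> u' -> v ~~> v' -> u ** v ~~> u' ** v'.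
Proof.
move=> [m [n [m0 n0 E]]] [m' [n' [m0' n0' E']]].
exists (pmul D m m'), (pmul D n n'); split; try exact: pmul_neq0.
by rewrite !zpairM pmulACA E E' pmulACA.
Qed.

Definition pregular (u : Zhat * Zhat) := forall x, pnorm (toZhat D) u * x = 0 -> x = 0.

Lemma pregularM u v : pregular u -> pregular v -> pregular (u ** v).
Proof. by move=> ru rv x; rewrite pnormM -mulrA => /ru/rv. Qed.

Lemma pregular_inj u v w : pregular u -> u ** v = u ** w -> v = w.
Proof.
move=> ru E; have := congr1 (pmul (toZhat D) (pconj u)) E.
have inj x y : pnorm (toZhat D) u * x = pnorm (toZhat D) u * y -> x = y.
  by move=> F; apply/eqP; rewrite -subr_eq0; apply/eqP/ru; rewrite mulrBr F subrr.
rewrite !pmul_conj => F; move: (inj _ _ (congr1 fst F)) (inj _ _ (congr1 snd F)).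
by case: v w {E F} => [a b] [a' b'] /= -> ->.
Qed.

Lemma proportional_cancel u v w : pregular u -> u ** v ~~> u ** w -> v ~~> w.
Proof.
move=> ru [m [n [m0 n0 E]]]; exists m, n; split=> //.
by apply: (pregular_inj ru); rewrite !pmulA ![u ** _]pmulC -!pmulA.
Qed.

Lemma proportional_scale u v : u ~~> v -> exists (m : int * int) (N : int),
  [/\ m != 0, 0 < N & zpair m ** u = (toZhat N * v.1, toZhat N * v.2)].
Proof.
move=> [m [n [m0 n0 E]]]; exists (pmul D (pconj n) m), (pnorm D n); split.
- apply: pmul_neq0 => //; apply: contraNN n0; case: n {E} => a b.
  by rewrite -[0]/(0, 0) !xpair_eqE /= oppr_eq0.
- exact: pnorm_gt0.
rewrite zpairM -pmulA E.
have -> : zpair (pconj n) = pconj (zpair n) by rewrite /zpair /pconj /= toZhatN.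
by rewrite pmul_conj /pnorm /= !expr2 !(toZhatM, toZhatD, toZhatN).
Qed.
End Proportional.

Definition qval (Q : qform int) (x y : Zhat) : Zhat :=
  toZhat (qa Q) * x ^+ 2 + toZhat (qb Q) * x * y + toZhat (qc Q) * y ^+ 2.

(* Twice the point x a + y (b + sqrt D) / 2 of the ideal attached to the form (a, b, c). *)
Definition theta (Q : qform int) (x y : Zhat) : Zhat * Zhat :=
  (2 * toZhat (qa Q) * x + toZhat (qb Q) * y, y).

Lemma mx2E (R : Type) (x y z t : R) : [/\ mx2 x y z t 0 0 = x, mx2 x y z t 0 1 = y,
  mx2 x y z t 1 0 = z & mx2 x y z t 1 1 = t].
Proof. by split; rewrite mxE. Qed.

Lemma mx2_eta (R : Type) (g : 'M[R]_2) : g = mx2 (g 0 0) (g 0 1) (g 1 0) (g 1 1).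
Proof.
apply/matrixP => i j; rewrite mxE.
case: i => -[|[|//]] Hi; case: j => -[|[|//]] Hj /=; congr (g _ _); exact: val_inj.
Qed.

Lemma mulmx2 (R : comNzRingType) (x y z t x' y' z' t' : R) :
  mx2 x y z t *m mx2 x' y' z' t' =
  mx2 (x * x' + y * z') (x * y' + y * t') (z * x' + t * z') (z * y' + t * t').
Proof.
apply/matrixP => i j; rewrite mxE !big_ord_recl big_ord0 addr0 !mxE.
by case: i => -[|[|//]] Hi; case: j => -[|[|//]] Hj.
Qed.

Lemma mx2_1 (R : comNzRingType) : 1%:M = mx2 1 0 0 1 :> 'M[R]_2.
Proof.
apply/matrixP => i j; rewrite !mxE.
by case: i => -[|[|//]] Hi; case: j => -[|[|//]] Hj.
Qed.

Lemma det2 (R : comNzRingType) (A : 'M[R]_2) : \det A = A 0 0 * A 1 1 - A 0 1 * A 1 0.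
Proof.
rewrite (expand_det_row _ 0) !big_ord_recl big_ord0 /cofactor !det_mx11 !mxE /= addr0.
rewrite expr0 expr1 mul1r mulN1r mulrN.
by congr (A _ _ * A _ _ - A _ _ * A _ _); apply: val_inj.
Qed.

Lemma SL2_mx2 (R : comNzRingType) (x y z t : R) : SL2 (mx2 x y z t) <-> x * t - y * z = 1.
Proof. by rewrite /SL2 det2; have [-> -> -> ->] := mx2E x y z t. Qed.

Lemma invmx2 (R : comUnitRingType) (x y z t : R) : x * t - y * z = 1 ->
  invmx (mx2 x y z t) = mx2 t (- y) (- z) x.
Proof.
move=> E; have U : mx2 x y z t \in unitmx by apply/SL2_unitmx/SL2_mx2.
apply: (can_inj (mulKmx U)); rewrite mulmxV // mulmx2 mx2_1.
by congr mx2; rewrite -?E; ring.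
Qed.

Lemma map_mx2 (R S : Type) (f : R -> S) x y z t :
  map_mx f (mx2 x y z t) = mx2 (f x) (f y) (f z) (f t).
Proof. by apply/matrixP => i j; rewrite !mxE; do ![case: ifP => //]. Qed.

Lemma qeval_col0 Q (g : 'M[Zhat]_2) :
  qeval (qmap toZhat Q) (col 0 g) = qval Q (g 0 0) (g 1 0).
Proof. by rewrite /qeval /qval !mxE. Qed.

Lemma qsubst2 (R : comNzRingType) (Q : qform R) (x y z t : R) :
  qsubst Q (mx2 x y z t) = QForm (qa Q * x ^+ 2 + qb Q * x * z + qc Q * z ^+ 2)
    (2 * qa Q * x * y + qb Q * (x * t + y * z) + 2 * qc Q * z * t)
    (qa Q * y ^+ 2 + qb Q * y * t + qc Q * t ^+ 2).
Proof.
by rewrite /qsubst /qeval !mxE /=; congr QForm; ring.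
Qed.

Lemma unit_toZhat_dvd (n : int) (z : Zhat) : toZhat n * z \is a GRing.unit -> (n %| 1)%Z.
Proof.
move=> U; apply: (@toZhat_dvd _ _ (z * (toZhat n * z)^-1)).
by rewrite mulrA mulrV.
Qed.

Lemma form_lead_gt0 D Q : is_form D Q -> 0 < qa Q.
Proof.
case=> _ pd _; have := pd (col 0 (mx2 1 0 0 1)); rewrite /qeval !mxE /=.
have -> : qa Q * 1 ^+ 2 + qb Q * 1 * 0 + qc Q * 0 ^+ 2 = qa Q by ring.
by apply; apply/eqP => /colP/(_ 0); rewrite !mxE.
Qed.

Lemma form_disc D Q : is_form D Q -> D = qb Q ^+ 2 - 4 * qa Q * qc Q.
Proof. by case=> _ _ <-. Qed.

Lemma is_form_of_unit D Q x y : D < 0 -> 0 < qa Q -> qdisc Q = D ->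
  qval Q x y \is a GRing.unit -> is_form D Q.
Proof.
case: Q => a b c; rewrite /qdisc /qval /= => D0 a0 ED U; split=> //.
- rewrite /qprimitive /=; set g := gcdz a _.
  have [a' Ea] := dvdzP (dvdz_gcdl a (gcdz b c) : (g %| a)%Z).
  have gbc : (g %| gcdz b c)%Z := dvdz_gcdr _ _.
  have [b' Eb] := dvdzP (dvdz_trans gbc (dvdz_gcdl b c)).
  have [c' Ec] := dvdzP (dvdz_trans gbc (dvdz_gcdr b c)).
  have : (g %| 1)%Z.
    apply: (@unit_toZhat_dvd _ (toZhat a' * x ^+ 2 + toZhat b' * x * y + toZhat c' * y ^+ 2)).
    by move: U; rewrite Ea Eb Ec !toZhatM; congr (_ \is a _); ring.
  by rewrite dvdz1; have : 0 <= g by []; lia.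
- move=> v v0; rewrite /qeval /=; set X := v 0 0; set Y := v 1 0.
  have : (0 < 4 * a * (a * X ^+ 2 + b * X * Y + c * Y ^+ 2)).
    have -> : 4 * a * (a * X ^+ 2 + b * X * Y + c * Y ^+ 2) = pnorm D (2 * a * X + b * Y, Y).
      by rewrite /pnorm /= -ED; ring.
    apply: pnorm_gt0 => //; rewrite -[0]/(0, 0) xpair_eqE; apply/negP => /andP[/eqP E /eqP Y0].
    move: E; rewrite Y0 mulr0 addr0 => /eqP; rewrite !mulf_eq0 /= (gt_eqF a0) /= => /eqP X0.
    move/eqP: v0; apply; apply/colP => i; rewrite mxE.
    by case: i => -[|[|//]] Hi; [rewrite -[RHS]X0|rewrite -[RHS]Y0]; congr (v _ _); apply: val_inj.
  by rewrite pmulr_rgt0 // pmulr_rgt0.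
Qed.

Lemma disc_parity (b b' k k' : int) : b ^+ 2 - 4 * k = b' ^+ 2 - 4 * k' ->
  exists e, b - b' = 2 * e.
Proof.
move=> E; have := divz_eq (b - b') 2; have := modz_ge0 (b - b') (isT : 2 != 0 :> int).
have := ltz_pmod (b - b') (isT : 0 < 2 :> int).
move: (_ %/ _)%Z (_ %% _)%Z => e r r2 r0 Er.
have [r00|r1] : r = 0 \/ r = 1 by lia.
  by exists e; rewrite Er r00; ring.
have Eb : b = b' + (e * 2 + 1) by move: Er; rewrite r1 => <-; ring.
suff : 4 * (k - k' - e * b' - e ^+ 2 - e) = 2 * b' + 1 by lia.
move: E; rewrite Eb => E; have E2 : 4 * (k - k') = (b' + (e * 2 + 1)) ^+ 2 - b' ^+ 2.
  by rewrite -[b' ^+ 2](addrK (- (4 * k'))) -E; ring.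
have -> : 4 * (k - k' - e * b' - e ^+ 2 - e) = 4 * (k - k') - 4 * (e * b' + e ^+ 2 + e) by ring.
by rewrite E2; ring.
Qed.

Lemma theta_inj (D : int) (Q Q' : qform int) (x y x' y' : Zhat) : D < 0 ->
  is_form D Q -> is_form D Q' ->
  qval Q x y \is a GRing.unit -> qval Q' x' y' \is a GRing.unit ->
  proportional D (theta Q x y) (theta Q' x' y') ->
  exists p q r s : int, [/\ p * s - q * r = 1, Q = qsubst Q' (mx2 p q r s),
    x' = toZhat p * x + toZhat q * y & y' = toZhat r * x + toZhat s * y].
Proof.
move=> D0 FQ FQ' U U' /(proportional_scale D0)[[m1 m2] [N [m0 N0 E]]].
have a0 := form_lead_gt0 FQ; have a0' := form_lead_gt0 FQ'.
have ED := form_disc FQ; have ED' := form_disc FQ'.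
case: Q Q' {FQ FQ'} U U' a0 a0' ED ED' E => a b c [a' b' c'] /=.
rewrite /qval /theta /zpair /pmul /= => U U' a0 a0' ED ED' E.
have H1 := congr1 fst E; have H2 := congr1 snd E; move: H1 H2 => /= {E}.
have [e Ee] : exists e, b - b' = 2 * e.
  by apply: (@disc_parity _ _ (a * c) (a' * c')); rewrite !mulrA -ED -ED'.
pose k := 2 * a' * N.
have k0 : k != 0 by rewrite /k !mulf_neq0 ?gt_eqF.
pose A11 := 2 * a * (m1 - b' * m2); pose A12 := m1 * (b - b') + m2 * (D - b * b').
pose A21 := 4 * a * a' * m2; pose A22 := 2 * a' * (b * m2 + m1).
move=> H1 H2.
have zinj : injective ( *%R (toZhat 2)) by exact: toZhat_lreg.
have I1 : toZhat A11 * x + toZhat A12 * y = toZhat k * x'.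
  rewrite /A11 /A12 /k !(toZhatM, toZhatD, toZhatN).
  transitivity (toZhat N * (2 * toZhat a' * x' + toZhat b' * y') - toZhat b' * (toZhat N * y'));
    last by rewrite /toZhat; ring.
  by rewrite -H1 -H2 /toZhat; ring.
have I2 : toZhat A21 * x + toZhat A22 * y = toZhat k * y'.
  rewrite /A21 /A22 /k !(toZhatM, toZhatD, toZhatN).
  transitivity (toZhat 2 * toZhat a' * (toZhat N * y')); last by rewrite /toZhat; ring.
  by rewrite -H2 /toZhat; ring.
have zD : toZhat D = toZhat b ^+ 2 - 4 * toZhat a * toZhat c.
  by rewrite ED !expr2 !(toZhatM, toZhatD, toZhatN) /toZhat; ring.
have zD' : 4 * toZhat a' * toZhat c' = toZhat b' ^+ 2 - toZhat D.
  by rewrite ED' !expr2 !(toZhatM, toZhatD, toZhatN) /toZhat; ring.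
have ze : 2 * toZhat e = toZhat b - toZhat b'.
  by rewrite -toZhatN -toZhatD Ee toZhatM.
pose w1 := - (toZhat c * y); pose w2 := toZhat a * x + toZhat b * y.
have J1 : toZhat A11 * w1 + toZhat A12 * w2 = toZhat k * (- (toZhat c' * y') + toZhat e * x').
  apply: zinj.
  transitivity (- (4 * toZhat a' * toZhat c') * (toZhat N * y') +
    (2 * toZhat e) * (toZhat N * (2 * toZhat a' * x' + toZhat b' * y') -
      toZhat b' * (toZhat N * y')));
    last by rewrite /k !toZhatM /toZhat; ring.
  rewrite -H1 -H2 zD' ze zD /A11 /A12 /w1 /w2 !(toZhatM, toZhatD, toZhatN) zD /toZhat; ring.
have J2 : toZhat A21 * w1 + toZhat A22 * w2
    = toZhat k * (toZhat a' * x' + toZhat b' * y' + toZhat e * y').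
  apply: zinj.
  transitivity (toZhat 2 * toZhat a' * ((toZhat N * (2 * toZhat a' * x' + toZhat b' * y')) +
    (toZhat b' + 2 * toZhat e) * (toZhat N * y')));
    last by rewrite /k !toZhatM /toZhat; ring.
  rewrite -H1 -H2 ze zD /A21 /A22 /w1 /w2 !(toZhatM, toZhatD, toZhatN) /toZhat; ring.
set V := _ + _ + _ in U; set V' := _ + _ + _ in U'.
have dvd A B z w : toZhat A * x + toZhat B * y = toZhat k * z ->
    toZhat A * w1 + toZhat B * w2 = toZhat k * w -> (k %| A)%Z /\ (k %| B)%Z.
  move=> F G; split.
    apply: (@toZhat_dvd _ _ ((z * w2 - w * y) * V^-1)); rewrite mulrA mulrBr !mulrA -F -G.
    rewrite -[RHS](mulrK U); congr (_ * _); rewrite /V /w1 /w2; ring.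
  apply: (@toZhat_dvd _ _ ((w * x - z * w1) * V^-1)); rewrite mulrA mulrBr !mulrA -F -G.
  rewrite -[RHS](mulrK U); congr (_ * _); rewrite /V /w1 /w2; ring.
have [/dvdzP[p Ep] /dvdzP[q Eq]] := dvd _ _ _ _ I1 J1.
have [/dvdzP[r Er] /dvdzP[s Es]] := dvd _ _ _ _ I2 J2.
have Ix : x' = toZhat p * x + toZhat q * y.
  apply: (toZhat_lreg k0); rewrite -I1 Ep Eq !toZhatM; ring.
have Iy : y' = toZhat r * x + toZhat s * y.
  apply: (toZhat_lreg k0); rewrite -I2 Er Es !toZhatM; ring.
have kinj : injective ( *%R (k ^+ 2)) by apply: mulfI; rewrite sqrf_eq0.
have ainj : injective ( *%R (4 * a')) by apply: mulfI; rewrite mulf_neq0 // gt_eqF.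
have det : k ^+ 2 * (p * s - q * r) = 4 * a * a' * pnorm D (m1, m2).
  transitivity ((p * k) * (s * k) - (q * k) * (r * k)); first by ring.
  rewrite -Ep -Eq -Er -Es /A11 /A12 /A21 /A22 /pnorm /= ED; ring.
have detx z : k ^+ 2 * (4 * a' * ((p * s - q * r) * z)) = 4 * a' * (4 * a * a' * pnorm D (m1,
  m2)) * z.
  by rewrite -det; ring.
have det_gt0 : 0 < p * s - q * r.
  by rewrite -(pmulr_rgt0 _ (_ : 0 < k ^+ 2)) ?det ?mulr_gt0 ?pnorm_gt0 // lt0r sqr_ge0 sqrf_eq0 k0.
have ED2 : 4 * a' * c' = b' ^+ 2 - b ^+ 2 + 4 * a * c.
  by rewrite -[b' ^+ 2](subrK (4 * a' * c')) -ED' ED; ring.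
have F : qsubst (QForm a' b' c') (mx2 p q r s) =
    QForm ((p * s - q * r) * a) ((p * s - q * r) * b) ((p * s - q * r) * c).
  rewrite qsubst2 /=; congr QForm; apply: ainj; apply: kinj.
  - rewrite /= detx.
    transitivity (4 * a' * (a' * (p * k) ^+ 2 + b' * (p * k) * (r * k)) +
      (4 * a' * c') * (r * k) ^+ 2); first by ring.
    rewrite -Ep -Er ED2 /A11 /A21 /pnorm /= ED; ring.
  - rewrite /= detx.
    transitivity (4 * a' * (2 * a' * (p * k) * (q * k) + b' * ((p * k) * (s * k) +
      (q * k) * (r * k))) + 2 * (4 * a' * c') * (r * k) * (s * k)); first by ring.
    rewrite -Ep -Eq -Er -Es ED2 /A11 /A12 /A21 /A22 /pnorm /= ED; ring.
  - rewrite /= detx.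
    transitivity (4 * a' * (a' * (q * k) ^+ 2 + b' * (q * k) * (s * k)) +
      (4 * a' * c') * (s * k) ^+ 2); first by ring.
    rewrite -Eq -Es ED2 /A12 /A22 /pnorm /= ED; ring.
have EV : V' = toZhat (p * s - q * r) * V.
  move: F; rewrite qsubst2 => F.
  have := congr1 (fun Q => toZhat (qa Q)) F; have := congr1 (fun Q => toZhat (qb Q)) F.
  have := congr1 (fun Q => toZhat (qc Q)) F;
    rewrite /= !expr2 !(toZhatM, toZhatD) -!expr2 => Fc Fb Fa.
  rewrite /V !mulrDr !mulrA -Fa -Fb -Fc /V' Ix Iy /toZhat; ring.
have det1 : p * s - q * r = 1.
  have : (p * s - q * r %| 1)%Z by apply: (@unit_toZhat_dvd _ V); rewrite -EV.
  by rewrite dvdz1; lia.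
by exists p, q, r, s; rewrite F det1 !mul1r.
Qed.

Lemma mulmx2E (R : comNzRingType) (A B : 'M[R]_2) i j :
  (A *m B) i j = A i 0 * B 0 j + A i 1 * B 1 j.
Proof.
by rewrite mxE !big_ord_recl big_ord0 addr0; congr (_ + A _ _ * B _ _); apply: val_inj.
Qed.

Lemma theta_act (D : int) (Q : qform int) (p q r s : int) (x y : Zhat) : D < 0 ->
  is_form D Q -> is_form D (qsubst Q (mx2 p q r s)) -> p * s - q * r = 1 ->
  proportional D (theta (qsubst Q (mx2 p q r s)) x y)
    (theta Q (toZhat p * x + toZhat q * y) (toZhat r * x + toZhat s * y)).
Proof.
move=> D0 FQ FQ' det; have a0 := form_lead_gt0 FQ; have := form_lead_gt0 FQ'.
have ED := form_disc FQ; case: Q FQ FQ' ED a0 => a b c FQ FQ' ED a0.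
rewrite !qsubst2 => a0'; rewrite /= in ED a0 a0' *.
set a' := a * p ^+ 2 + b * p * r + c * r ^+ 2 in a0' *.
exists (2 * a * p + b * r, r), (2 * a', 0); split.
- rewrite -[0]/(0, 0) xpair_eqE; apply/negP => /andP[/eqP E /eqP r0].
  move: E det; rewrite r0 mulr0 addr0 => /eqP; rewrite !mulf_eq0 /= (gt_eqF a0) /= => /eqP ->.
  by rewrite mul0r mulr0 subr0.
- by rewrite -[X in _ != X]/(0, 0) xpair_eqE /= andbT mulf_neq0 // lt0r_neq0.
have zdet : toZhat p * toZhat s - toZhat q * toZhat r = 1.
  by rewrite -!toZhatM -toZhatN -toZhatD det.
have zD : toZhat D = toZhat b ^+ 2 - 4 * toZhat a * toZhat c.
  by rewrite ED !expr2 !(toZhatM, toZhatD, toZhatN) /toZhat; ring.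
rewrite /theta /zpair /pmul /= /a' !expr2 !(toZhatM, toZhatD, toZhatN) zD.
have one : y = (toZhat p * toZhat s - toZhat q * toZhat r) * y by rewrite zdet mul1r.
move: (toZhat p) (toZhat q) (toZhat r) (toZhat s) (toZhat a) (toZhat b)
  (toZhat c) zdet one => zp zq zr zs za zb zc zdet one.
congr pair.
- by rewrite [in X in _ + X]one /toZhat; ring.
- by rewrite [X in _ * X + _]one /toZhat; ring.
Qed.

Definition lead_val D (X : framed D) : Zhat := qval (framed_form X) (framed_mx X 0 0)
  (framed_mx X 1 0).
Definition mid_val D (X : framed D) : Zhat := qb (qsubst (qmap toZhat (framed_form X))
  (framed_mx X)).
Definition mid_shift D (X : framed D) : Zhat := mid_val X - toZhat (qb (principal_form D)).
Definition framed_theta D (X : framed D) : Zhat * Zhat :=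
  theta (framed_form X) (framed_mx X 0 0) (framed_mx X 1 0).

Lemma framed_eta D (X : framed D) : val X = (framed_form X, framed_mx X).
Proof. by rewrite /framed_form /framed_mx; case: (val X). Qed.

Lemma framedP D (X : framed D) : is_framed D (framed_form X, framed_mx X).
Proof. by case: X => [[Q g] H] /=; apply/asboolP. Qed.

Lemma framed_isform D (X : framed D) : is_form D (framed_form X).
Proof. by have [] := framedP X. Qed.

Lemma framed_unit D (X : framed D) : lead_val X \is a GRing.unit.
Proof. by have [_ _] := framedP X; rewrite qeval_col0. Qed.

Lemma framed_det D (X : framed D) :
  framed_mx X 0 0 * framed_mx X 1 1 - framed_mx X 0 1 * framed_mx X 1 0 = 1.
Proof. by have [_ + _] := framedP X; rewrite /SL2 det2. Qed.

Lemma qmap_qsubst Q (g : 'M[int]_2) :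
  qmap toZhat (qsubst Q g) = qsubst (qmap toZhat Q) (map_mx toZhat g).
Proof.
rewrite (mx2_eta g) map_mx2 !qsubst2 /qmap /=.
by congr QForm; rewrite ?expr2 !(toZhatM, toZhatD) /toZhat; ring.
Qed.

Lemma same_orbit_mid D (X Y : framed D) : same_orbit X Y -> mid_val X = mid_val Y.
Proof.
move=> /asboolP[al al1 E]; rewrite /mid_val.
have -> : framed_form Y = qsubst (framed_form X) al by rewrite /framed_form E.
have -> : framed_mx Y = invmx (map_mx toZhat al) *m framed_mx X by rewrite /framed_mx E.
rewrite qmap_qsubst qsubstM mulmxA mulmxV ?mul1mx //.
by apply/SL2_unitmx/SL2_map.
Qed.

Lemma same_orbit_theta D (X Y : framed D) : D < 0 -> same_orbit X Y ->
  proportional D (framed_theta X) (framed_theta Y).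
Proof.
move=> D0 /asboolP[al al1 E]; apply: proportional_sym.
have EQ : framed_form Y = qsubst (framed_form X) al by rewrite /framed_form E.
have Eg : framed_mx X = map_mx toZhat al *m framed_mx Y.
  rewrite /framed_mx E /= mulmxA mulmxV ?mul1mx //; exact/SL2_unitmx/SL2_map.
have FY := framed_isform Y; have FX := framed_isform X.
rewrite /framed_theta Eg !mulmx2E; move: FY; rewrite EQ (mx2_eta al) map_mx2.
have [-> -> -> ->] := mx2E (toZhat (al 0 0)) (toZhat (al 0 1)) (toZhat (al 1 0)) (toZhat (al 1 1)).
move=> FY; apply: theta_act => //.
by move: al1; rewrite /SL2 det2.
Qed.

(* With the first column and the determinant fixed, the second column can only
   move by t times the first, which changes the middle coefficient by 2 t times a unit. *)
Lemma frame_eq Q (g h : 'M[Zhat]_2) : \det g = 1 -> \det h = 1 ->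
  g 0 0 = h 0 0 -> g 1 0 = h 1 0 -> qval Q (g 0 0) (g 1 0) \is a GRing.unit ->
  qb (qsubst (qmap toZhat Q) g) = qb (qsubst (qmap toZhat Q) h) -> g = h.
Proof.
rewrite !det2 (mx2_eta g) (mx2_eta h) !qsubst2 /qval.
move: (g 0 0) (g 0 1) (g 1 0) (g 1 1) (h 0 0) (h 0 1) (h 1 0) (h 1 1).
move=> x y z t x' y' z' t'.
have [-> -> -> ->] := mx2E x y z t; have [-> -> -> ->] := mx2E x' y' z' t'.
move=> dg dh Ex Ez; subst x' z'; rewrite /=.
set a := toZhat _; set b := toZhat _; set c := toZhat _ => U E.
pose k := y' * t - t' * y.
have Ey : y' = y + k * x.
  transitivity ((x * t - y * z) * y' - (x * t' - y' * z) * y + y); last by rewrite /k; ring.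
  by rewrite dg dh; ring.
have Et : t' = t + k * z.
  transitivity ((x * t - y * z) * t' - (x * t' - y' * z) * t + t); last by rewrite /k; ring.
  by rewrite dg dh; ring.
suff k0 : k = 0 by rewrite Ey Et k0 !mul0r !addr0.
apply: (@toZhat_reg 2) => //; apply: (mulrI U); rewrite mulr0.
move: E => /eqP; rewrite eq_sym -subr_eq0 => /eqP <-; rewrite Ey Et /toZhat; ring.
Qed.

Lemma class_eqP D (X Y : framed D) : D < 0 ->
  Chat_class X = Chat_class Y <->
  proportional D (framed_theta X) (framed_theta Y) /\ mid_shift X = mid_shift Y.
Proof.
move=> D0; split.
  move=> /eqmodP O; split; first exact: same_orbit_theta.
  by rewrite /mid_shift (same_orbit_mid O).
move=> [P /addIr E]; apply/eqP; rewrite eq_sym eqmodE.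
have [p [q [r [s [det EQ Ex Ey]]]]] :=
  theta_inj D0 (framed_isform X) (framed_isform Y) (framed_unit X) (framed_unit Y) P.
have al1 : SL2 (mx2 p q r s) by apply/SL2_mx2.
have U := SL2_unitmx (SL2_map al1).
apply/asboolP; exists (mx2 p q r s) => //; rewrite /framed_act.
rewrite (framed_eta X) -/(framed_form Y) -/(framed_mx Y) -EQ; congr pair.
apply: (canRL (mulKmx U)).
have Eg i j : (map_mx toZhat (mx2 p q r s) *m framed_mx X) i j =
    toZhat (mx2 p q r s i 0) * framed_mx X 0 j + toZhat (mx2 p q r s i 1) * framed_mx X 1 j.
  by rewrite mulmx2E; congr (_ * _ + _ * _); rewrite [LHS]mxE.
have [p0 p1 p2 p3] := mx2E p q r s.
apply: (@frame_eq (framed_form Y)).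
- by rewrite det_mulmx (SL2_map al1) det2 framed_det mulr1.
- by rewrite det2 framed_det.
- by rewrite Eg p0 p1 Ex.
- by rewrite Eg p2 p3 Ey.
- rewrite !Eg p0 p1 p2 p3 -Ex -Ey; exact: framed_unit.
by rewrite -qsubstM -qmap_qsubst -EQ.
Qed.

Lemma lead_val_class D (X Y : framed D) : D < 0 ->
  proportional D (framed_theta X) (framed_theta Y) -> lead_val X = lead_val Y.
Proof.
move=> D0 P; have [p [q [r [s [det EQ Ex Ey]]]]] :=
  theta_inj D0 (framed_isform X) (framed_isform Y) (framed_unit X) (framed_unit Y) P.
rewrite /lead_val EQ Ex Ey qsubst2 /qval /= !expr2 !(toZhatM, toZhatD) /toZhat; ring.
Qed.

Lemma theta_regular D Q x y : D < 0 -> is_form D Q -> qval Q x y \is a GRing.unit ->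
  pregular D (theta Q x y).
Proof.
move=> D0 FQ U z; have a0 := form_lead_gt0 FQ; have ED := form_disc FQ.
have -> : pnorm (toZhat D) (theta Q x y) = toZhat (4 * qa Q) * qval Q x y.
  rewrite /pnorm /theta /qval ED /= !expr2 !(toZhatM, toZhatD, toZhatN) /toZhat; ring.
rewrite -mulrA => /toZhat_reg E; apply: (mulrI U); rewrite mulr0; apply: E.
by rewrite mulf_neq0 // gt_eqF.
Qed.

Lemma principal_disc D : neg_discriminant D -> qdisc (principal_form D) = D.
Proof. by case=> D0 H; rewrite /qdisc /principal_form; case: eqP => E /=; lia. Qed.

Lemma principal_lead D : qa (principal_form D) = 1.
Proof. by rewrite /principal_form; case: eqP. Qed.

Lemma principal_is_form D : neg_discriminant D -> is_form D (principal_form D).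
Proof.
move=> nD; have [D0 _] := nD; apply: (@is_form_of_unit _ _ 1 0) => //.
- by rewrite principal_lead.
- exact: principal_disc.
by rewrite /qval principal_lead !expr2 !mulr0 !addr0 !mulr1 toZhat1 unitr1.
Qed.

Lemma middle_parity D Q : neg_discriminant D -> is_form D Q ->
  exists e, qb Q - qb (principal_form D) = 2 * e.
Proof.
move=> nD FQ; apply: (@disc_parity _ _ (qa Q * qc Q)
  (qa (principal_form D) * qc (principal_form D))).
by rewrite !mulrA -(form_disc FQ) -/(qdisc (principal_form D)) principal_disc.
Qed.

Lemma mid_shift_even D (X : framed D) : neg_discriminant D -> exists z, mid_shift X = 2 * z.
Proof.
move=> nD; have [e Ee] := middle_parity nD (framed_isform X).
have dX := framed_det X.
rewrite /mid_shift /mid_val (mx2_eta (framed_mx X)) qsubst2 /=.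
have {Ee}Eb : qb (framed_form X) = qb (principal_form D) + 2 * e by rewrite -Ee; ring.
rewrite Eb !(toZhatM, toZhatD); move: dX.
move: (framed_mx X 0 0) (framed_mx X 0 1) (framed_mx X 1 0) (framed_mx X 1 1) => x y z t dX.
have -> : x * t = 1 + y * z by rewrite -dX; ring.
set a := toZhat (qa _); set b := toZhat (qb _); set c := toZhat (qc _).
exists (a * x * y + b * y * z + toZhat e * (1 + 2 * y * z) + c * z * t); rewrite /toZhat; ring.
Qed.

Lemma framed_exists D Q x y z : neg_discriminant D -> is_form D Q ->
  qval Q x y \is a GRing.unit ->
  exists X : framed D, [/\ framed_form X = Q, framed_mx X 0 0 = x, framed_mx X 1 0 = y
    & mid_shift X = 2 * z].
Proof.
move=> nD FQ U; have [e Ee] := middle_parity nD FQ.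
set V := qval Q x y in U; pose t := V^-1 * (z - toZhat e).
pose g := mx2 x (- (toZhat (qc Q) * y * V^-1) + t * x)
  y ((toZhat (qa Q) * x + toZhat (qb Q) * y) * V^-1 + t * y).
have [g0 g1 g2 g3] := mx2E x (- (toZhat (qc Q) * y * V^-1) + t * x)
  y ((toZhat (qa Q) * x + toZhat (qb Q) * y) * V^-1 + t * y).
have FX : is_framed D (Q, g).
  split=> //=; last by rewrite qeval_col0 /g g0 g2.
  apply/SL2_mx2; rewrite -[RHS](mulrV U) /V /qval; ring.
exists (exist _ (Q, g) (asboolT FX)); split=> //=; rewrite /framed_mx /= /g ?g0 ?g2 //.
rewrite /mid_shift /mid_val -[framed_form _]/Q -[framed_mx _]/g /g qsubst2 /=.
have -> : toZhat (qb (principal_form D)) = toZhat (qb Q) - 2 * toZhat e.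
  have -> : qb (principal_form D) = qb Q - 2 * e by rewrite -Ee; ring.
  by rewrite toZhatD toZhatN toZhatM.
have K : V * t = z - toZhat e by rewrite /t mulrA mulrV // mul1r.
have K' : V * V^-1 = 1 by rewrite mulrV.
move: t V^-1 K K' {g FX g0 g1 g2 g3} => t W K K'.
transitivity (2 * (V * t) + 2 * toZhat e + toZhat (qb Q) * (V * W) - toZhat (qb Q)).
  rewrite /V /qval; ring.
by rewrite K K'; ring.
Qed.

Lemma coprime_shift (x n y : nat) : (0 < x)%N -> (0 < y)%N -> coprime (gcdn x n) y ->
  exists t, coprime (x + n * t) y.
Proof.
move=> x0 y0 co; exists (y`_(\pi(x)^'))%N.
rewrite coprime_has_primes ?addn_gt0 ?x0 //; apply/hasPn => q.
rewrite mem_primes => /and3P[pq _ qy]; apply/negP; rewrite mem_primes => /and3P[_ _ qxt].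
have [qx|qx] := boolP (q %| x)%N.
  have : (q %| n * y`_(\pi(x)^'))%N by rewrite -(dvdn_addr _ qx).
  rewrite Euclid_dvdM // => /orP[qn|qt].
    have := coprime_dvdl (_ : q %| gcdn x n)%N co; rewrite dvdn_gcd qx qn => /(_ isT).
    by rewrite prime_coprime // qy.
  have := part_pnat_id; have := pnat_dvd qt (part_pnat _ _); rewrite pnatE // inE /= inE.
  by rewrite mem_primes pq x0 qx.
have qt : (q %| y`_(\pi(x)^'))%N.
  have <- : (q`_(\pi(x)^') = q)%N.
    by apply: part_pnat_id; rewrite pnatE // inE /= inE mem_primes pq x0 (negPf qx).
  exact: partn_dvd.
by move: qxt; rewrite dvdn_addl ?(negPf qx) // dvdn_mull.
Qed.

Lemma strong_approximation Q x y (n : nat) : (0 < n)%N -> qval Q x y \is a GRing.unit ->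
  exists (p q r s : int) (u v : Zhat), [/\ p * s - q * r = 1,
    x = toZhat p + toZhat n * u & y = toZhat r + toZhat n * v].
Proof.
move=> n0 U.
have [rx [u [_ Ex]]] := zhat_euclid x n0; have [ry [v [_ Ey]]] := zhat_euclid y n0.
pose x0 := (rx + n)%N; pose y0 := (ry + n)%N.
have x00 : (0 < x0)%N by rewrite /x0 addn_gt0 n0 orbT.
have y00 : (0 < y0)%N by rewrite /y0 addn_gt0 n0 orbT.
have co : coprime (gcdn x0 n) y0.
  rewrite /coprime; set g := gcdn _ _.
  have gn : (g %| n)%N := dvdn_trans (dvdn_gcdl _ _) (dvdn_gcdr _ _).
  have /dvdnP[g1 E1] : (g %| rx)%N.
    by rewrite -(dvdn_addl _ gn); exact: dvdn_trans (dvdn_gcdl _ _) (dvdn_gcdl _ _).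
  have /dvdnP[g2 E2] : (g %| ry)%N by rewrite -(dvdn_addl _ gn); exact: dvdn_gcdr.
  have /dvdnP[g3 E3] := gn.
  have : (g %| 1)%Z.
    pose X := g1%:R + g3%:R * u; pose Y := g2%:R + g3%:R * v.
    apply: (@unit_toZhat_dvd _ (toZhat g * qval Q X Y)).
    move: U; congr (_ \is a _); rewrite Ex Ey E1 E2 E3 /qval /X /Y toZhat_nat !natrM; ring.
  by rewrite dvdz1 absz_nat.
have [t cot] := coprime_shift x00 y00 co.
have [m [k Emk]] := bezout_int cot.
exists (x0 + n * t)%N, (- k), y0, m, (u - 1 - t%:R), (v - 1); split.
- by rewrite mulNr opprK [k * _]mulrC.
- rewrite !toZhat_nat /x0 Ex !natrD natrM; ring.
- rewrite !toZhat_nat /y0 Ey !natrD; ring.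
Qed.

Lemma qval_act Q (p q r s : int) x y : qval (qsubst Q (mx2 p q r s)) x y =
  qval Q (toZhat p * x + toZhat q * y) (toZhat r * x + toZhat s * y).
Proof. rewrite qsubst2 /qval /= !expr2 !(toZhatM, toZhatD) /toZhat; ring. Qed.

Lemma is_form_act D Q (p q r s : int) x y : D < 0 -> is_form D Q -> p * s - q * r = 1 ->
  qval Q x y \is a GRing.unit -> is_form D (qsubst Q (mx2 p q r s)).
Proof.
move=> D0 FQ det U.
apply: (@is_form_of_unit _ _ (toZhat s * x - toZhat q * y) (toZhat p * y - toZhat r * x)) => //.
- have [_ pd _] := FQ; apply: pd; apply/eqP => /colP E.
  have := E 0; have := E 1; rewrite !mxE /= => r0 p0.
  by move: det; rewrite r0 p0 mul0r mulr0 subr0.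
- rewrite qsubst2 /qdisc /=; have := form_disc FQ.
  move: (qa _) (qb _) (qc _) => a b c E.
  transitivity ((p * s - q * r) ^+ 2 * D); last by rewrite det expr1n mul1r.
  rewrite E; ring.
- rewrite qval_act; move: U; congr (qval _ _ _ \is a _).
    transitivity ((toZhat p * toZhat s - toZhat q * toZhat r) * x).
      by rewrite -!toZhatM -toZhatN -toZhatD det mul1r.
    ring.
  transitivity ((toZhat p * toZhat s - toZhat q * toZhat r) * y).
    by rewrite -!toZhatM -toZhatN -toZhatD det mul1r.
  ring.
Qed.

Lemma framed_act_is_framed D (X : framed D) al : D < 0 -> SL2 al ->
  is_framed D (framed_act (framed_form X, framed_mx X) al).
Proof.
move=> D0 al1; have U := SL2_unitmx (SL2_map al1).
have uX : qeval (qmap toZhat (qsubst (framed_form X) al))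
  (col 0 (invmx (map_mx toZhat al) *m framed_mx X)) \is a GRing.unit.
  rewrite qmap_qsubst qeval_subst colE !mulmxA mulmxV // mul1mx -colE qeval_col0.
  exact: framed_unit.
split=> //=; last first.
  by rewrite /SL2 det_mulmx det_inv (SL2_map al1) invr1 mul1r det2 framed_det.
rewrite (mx2_eta al); apply: is_form_act (framed_unit X) => //; first exact: framed_isform.
by move: al1; rewrite /SL2 det2.
Qed.

(** * Composition *)

Lemma theta_norm D Q x y : D = qdisc Q ->
  pnorm (toZhat D) (theta Q x y) = toZhat (4 * qa Q) * qval Q x y.
Proof.
move=> ->; rewrite /qdisc /pnorm /theta /qval /= !expr2 !(toZhatM, toZhatD, toZhatN) /toZhat; ring.
Qed.

Lemma compose_theta (D a1 b1 a2 b2 B C k1 k2 : int) (c1 c2 : int) (r1 s1 r2 s2 : Zhat) :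
  B = b1 + 2 * a1 * k1 -> B = b2 + 2 * a2 * k2 -> B ^+ 2 - D = 4 * a1 * a2 * C ->
  let mu1 := s1 + r1 * toZhat k1 in
  let mu2 := s2 + r2 * toZhat k2 in
  let r := - toZhat B * r1 * r2 + toZhat a2 * r1 * mu2 + toZhat a1 * r2 * mu1 in
  let s := mu1 * mu2 - toZhat C * r1 * r2 in
  pmul (toZhat D) (zpair (2, 0)) (theta (QForm (a1 * a2) B C) s (- r)) =
  pmul (toZhat D) (theta (QForm a1 b1 c1) s1 (- r1)) (theta (QForm a2 b2 c2) s2 (- r2)).
Proof.
move=> E1 E2 ED /=; rewrite /pmul /theta /zpair /=.
have -> : toZhat D = toZhat B ^+ 2 - 4 * toZhat a1 * toZhat a2 * toZhat C.
  have -> : D = B ^+ 2 - 4 * a1 * a2 * C by rewrite -ED; ring.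
  by rewrite !expr2 !(toZhatM, toZhatD, toZhatN) /toZhat; ring.
have -> : toZhat b1 = toZhat B - 2 * toZhat a1 * toZhat k1.
  have -> : b1 = B - 2 * a1 * k1 by rewrite E1; ring.
  by rewrite !(toZhatM, toZhatD, toZhatN) /toZhat; ring.
have -> : toZhat b2 = toZhat B - 2 * toZhat a2 * toZhat k2.
  have -> : b2 = B - 2 * a2 * k2 by rewrite E2; ring.
  by rewrite !(toZhatM, toZhatD, toZhatN) /toZhat; ring.
by congr pair; rewrite !toZhatM /toZhat; ring.
Qed.

Lemma concordantP D Q1 Q2 B : is_form D Q1 -> is_form D Q2 -> concordant D Q1 Q2 B ->
  [/\ B = qb Q1 + 2 * qa Q1 * ((B - qb Q1) %/ (2 * qa Q1))%Z,
      B = qb Q2 + 2 * qa Q2 * ((B - qb Q2) %/ (2 * qa Q2))%Z &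
      B ^+ 2 - D = 4 * qa Q1 * qa Q2 * qc (composed_form D Q1 Q2 B)].
Proof.
move=> F1 F2 [_ H1 H2 H3]; split.
- have /divzK E : (2 * qa Q1 %| B - qb Q1)%Z by rewrite -eqz_mod_dvd; apply/eqP.
  by rewrite [_ * (_ %/ _)%Z]mulrC E; ring.
- have /divzK E : (2 * qa Q2 %| B - qb Q2)%Z by rewrite -eqz_mod_dvd; apply/eqP.
  by rewrite [_ * (_ %/ _)%Z]mulrC E; ring.
have /divzK E : (4 * qa Q1 * qa Q2 %| B ^+ 2 - D)%Z by rewrite -eqz_mod_dvd; apply/eqP.
by rewrite /= mulrC E.
Qed.

Lemma composed_disc D Q1 Q2 B : is_form D Q1 -> is_form D Q2 -> concordant D Q1 Q2 B ->
  qdisc (composed_form D Q1 Q2 B) = D.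
Proof.
move=> F1 F2 H; have [_ _] := concordantP F1 F2 H; rewrite /qdisc /=.
by move: (_ %/ _)%Z => C E; rewrite !mulrA -E; ring.
Qed.

Section Compose.
Variables (D : int) (X1 X2 : framed D) (B : int).
Hypothesis D0 : D < 0.
Let Q1 := framed_form X1.
Let Q2 := framed_form X2.
Hypothesis con : concordant D Q1 Q2 B.
Let R := composed_form D Q1 Q2 B.
Let r1 := invmx (framed_mx X1) 1 0.
Let s1 := invmx (framed_mx X1) 1 1.
Let r2 := invmx (framed_mx X2) 1 0.
Let s2 := invmx (framed_mx X2) 1 1.
Let mu1 := s1 + r1 * toZhat ((B - qb Q1) %/ (2 * qa Q1))%Z.
Let mu2 := s2 + r2 * toZhat ((B - qb Q2) %/ (2 * qa Q2))%Z.
Let r := - toZhat B * r1 * r2 + toZhat (qa Q2) * r1 * mu2 + toZhat (qa Q1) * r2 * mu1.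
Let s := mu1 * mu2 - toZhat (qc R) * r1 * r2.

Lemma inv_frame (X : framed D) :
  invmx (framed_mx X) 1 0 = - framed_mx X 1 0 /\ invmx (framed_mx X) 1 1 = framed_mx X 0 0.
Proof.
rewrite (mx2_eta (framed_mx X)) invmx2; last exact: framed_det.
by split; rewrite !mxE.
Qed.

Lemma composed_theta : pmul (toZhat D) (zpair (2, 0)) (theta R s (- r)) =
  pmul (toZhat D) (framed_theta X1) (framed_theta X2).
Proof.
have [E1 E2 E3] := concordantP (framed_isform X1) (framed_isform X2) con.
have := @compose_theta D (qa Q1) (qb Q1) (qa Q2) (qb Q2) B (qc R) _ _ (qc Q1) (qc Q2)
  r1 s1 r2 s2 E1 E2 E3.
rewrite /= -/mu1 -/mu2 -/r -/s /framed_theta -/Q1 -/Q2 /r1 /s1 /r2 /s2.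
have [-> ->] := inv_frame X1; have [-> ->] := inv_frame X2; rewrite !opprK.
by move=> H; exact: H.
Qed.

Lemma composed_lead : qval R s (- r) = lead_val X1 * lead_val X2.
Proof.
have F1 := framed_isform X1; have F2 := framed_isform X2.
have := congr1 (pnorm (toZhat D)) composed_theta.
rewrite !pnormM !theta_norm; try by [exact: (form_disc F1)|exact: (form_disc F2)].
  rewrite -/Q1 -/Q2 -/(lead_val X1) -/(lead_val X2) => E.
  have a10 := form_lead_gt0 F1; have a20 := form_lead_gt0 F2.
  apply: (@toZhat_lreg (16 * qa Q1 * qa Q2)); first by rewrite !mulf_neq0 // gt_eqF.
  transitivity (pnorm (toZhat D) (zpair (2, 0)) * (toZhat (4 * qa R) * qval R s (- r))).
    by rewrite /pnorm /= !toZhatM toZhat0 /toZhat; ring.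
  by rewrite E !toZhatM /toZhat; ring.
exact/esym/(composed_disc F1 F2 con).
Qed.

Lemma composed_mx_unfold (nu : 'M[Zhat]_2) :
  composed_mx D Q1 Q2 B (framed_mx X1) (framed_mx X2) nu <->
  exists u0 v0 h1 h2 k : Zhat,
    let m := - 2 * toZhat (qa R) * v0 * s + toZhat B * (u0 * s + v0 * r)
             - 2 * toZhat (qc R) * u0 * r in
    [/\ u0 * s - v0 * r = 1,
        2 * h1 = mid_shift X1,
        2 * h2 = mid_shift X2,
        2 * (lead_val X1 * lead_val X2) * k = m -
         (toZhat (qb (principal_form D)) + 2 * (lead_val X2)^-1 * h1 + 2 * h2)
      & nu = invmx (mx2 (u0 + k * r) (v0 + k * s) r s)].
Proof.
have E1 : qa (qsubst (qmap toZhat Q1) (framed_mx X1)) = lead_val X1 by exact: qeval_col0.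
have E2 : qa (qsubst (qmap toZhat Q2) (framed_mx X2)) = lead_val X2 by exact: qeval_col0.
by rewrite /composed_mx; cbv zeta; rewrite E1 E2.
Qed.

Lemma composed_nu (u0 v0 k : Zhat) : u0 * s - v0 * r = 1 ->
  invmx (mx2 (u0 + k * r) (v0 + k * s) r s) = mx2 s (- (v0 + k * s)) (- r) (u0 + k * r).
Proof. by move=> E; apply: invmx2; rewrite -E; ring. Qed.

Lemma composition_invariants (Y : framed D) :
  framed_form Y = R -> composed_mx D Q1 Q2 B (framed_mx X1) (framed_mx X2) (framed_mx Y) ->
  [/\ proportional D (framed_theta Y) (pmul (toZhat D) (framed_theta X1) (framed_theta X2)),
      lead_val Y = lead_val X1 * lead_val X2
    & mid_shift Y = (lead_val X2)^-1 * mid_shift X1 + mid_shift X2].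
Proof.
move=> EY /composed_mx_unfold[u0 [v0 [h1 [h2 [k]]]]].
set m := (X in let m := X in _); move=> /= [Euv E1 E2 Ek Enu].
move: Enu; rewrite composed_nu // => Enu.
have [n0 n1 n2 n3] := mx2E s (- (v0 + k * s)) (- r) (u0 + k * r).
split.
- rewrite /framed_theta EY Enu n0 n2; exists (2, 0), (1, 0); split=> //.
  by rewrite composed_theta pmul1.
- by rewrite /lead_val EY Enu n0 n2 composed_lead.
- rewrite -E1 -E2 /mid_shift /mid_val EY Enu qsubst2.
  have -> : (lead_val X2)^-1 * (2 * h1) + 2 * h2 =
    (m - 2 * (lead_val X1 * lead_val X2) * k) - toZhat (qb (principal_form D)).
    rewrite Ek; ring.
  by rewrite -composed_lead /m /qval /=; ring.
Qed.

Lemma composed_exists : neg_discriminant D -> exists Y : framed D,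
  framed_form Y = R /\ composed_mx D Q1 Q2 B (framed_mx X1) (framed_mx X2) (framed_mx Y).
Proof.
move=> nD; have [h1 E1] := mid_shift_even X1 nD; have [h2 E2] := mid_shift_even X2 nD.
have U1 := framed_unit X1; have U2 := framed_unit X2.
pose V := lead_val X1 * lead_val X2; have U : V \is a GRing.unit by rewrite unitrM U1.
have EV : V = qval R s (- r) by rewrite composed_lead.
pose u0 := V^-1 * (toZhat (qa R) * s - toZhat B * r); pose v0 := - (V^-1 * toZhat (qc R) * r).
have Euv : u0 * s - v0 * r = 1.
  by rewrite -(mulVr U) {2}EV /u0 /v0 /qval /=; ring.
have [e Ee] : exists e, B - qb (principal_form D) = 2 * e.
  apply: (@disc_parity _ _ (qa R * qc R) (qa (principal_form D) * qc (principal_form D))).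
  rewrite !mulrA -/(qdisc (principal_form D)) principal_disc //.
  have [_ _ E] := concordantP (framed_isform X1) (framed_isform X2) con.
  by rewrite -E; ring.
pose j := - toZhat (qa R) * v0 * s + toZhat e + toZhat B * v0 * r - toZhat (qc R) * u0 * r
  - (lead_val X2)^-1 * h1 - h2.
pose k := V^-1 * j.
have Ek : 2 * V * k = - 2 * toZhat (qa R) * v0 * s + toZhat B * (u0 * s + v0 * r)
             - 2 * toZhat (qc R) * u0 * r -
         (toZhat (qb (principal_form D)) + 2 * (lead_val X2)^-1 * h1 + 2 * h2).
  have -> : u0 * s = 1 + v0 * r by rewrite -Euv; ring.
  have -> : toZhat (qb (principal_form D)) = toZhat B - 2 * toZhat e.
    have -> : qb (principal_form D) = B - 2 * e by rewrite -Ee; ring.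
    by rewrite toZhatD toZhatN toZhatM.
  rewrite -mulrA [V * k]mulrA mulrV // /j; ring.
pose nu := mx2 s (- (v0 + k * s)) (- r) (u0 + k * r).
have [n0 n1 n2 n3] := mx2E s (- (v0 + k * s)) (- r) (u0 + k * r).
have FY : is_framed D (R, nu).
  have UR : qval R s (- r) \is a GRing.unit by rewrite -EV.
  split=> /=; last by rewrite qeval_col0 /nu n0 n2.
    apply: is_form_of_unit UR => //; last by rewrite composed_disc //; exact: framed_isform.
    by rewrite mulr_gt0 //; apply: form_lead_gt0; exact: framed_isform.
  by apply/SL2_mx2; rewrite -Euv; ring.
exists (exist _ (R, nu) (asboolT FY)); split=> //.
apply/composed_mx_unfold; exists u0, v0, h1, h2, k; split=> //.
by rewrite composed_nu.
Qed.
End Compose.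

Lemma framed_act_exists D (X : framed D) al : D < 0 -> SL2 al ->
  exists X' : framed D, val X' = framed_act (val X) al.
Proof.
move=> D0 al1; have F := framed_act_is_framed X D0 al1.
by exists (exist (fun Y => `[< is_framed D Y >]) _ (asboolT F)); rewrite (framed_eta X).
Qed.

Lemma framed_act_class D (X X' : framed D) al : SL2 al ->
  val X' = framed_act (val X) al -> Chat_class X = Chat_class X'.
Proof. by move=> al1 E; apply/eqmodP/asboolP; exists al. Qed.

Lemma concordant_exists D Q1 Q2 : is_form D Q1 -> is_form D Q2 ->
  gcdz (qa Q1) (qa Q2) = 1 -> exists B, concordant D Q1 Q2 B.
Proof.
move=> F1 F2 co; have E1 := form_disc F1; have E2 := form_disc F2.
have [u [v Euv]] := Bezoutz (qa Q1) (qa Q2).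
rewrite co in Euv.
have [e Ee] : exists e, qb Q2 - qb Q1 = 2 * e.
  by apply: (@disc_parity _ _ (qa Q2 * qc Q2) (qa Q1 * qc Q1)); rewrite !mulrA -E1 -E2.
case: Q1 Q2 E1 E2 {F1 F2} co Euv Ee => [a1 b1 c1] [a2 b2 c2] /= E1 E2 co Euv Ee.
exists (b1 + 2 * a1 * (u * e)); split => /=.
- by rewrite gcdzA co gcd1z.
- by apply/eqP; rewrite eqz_mod_dvd; apply/dvdzP; exists (u * e); ring.
- apply/eqP; rewrite eqz_mod_dvd; apply/dvdzP; exists (- (v * e)).
  have -> : b2 = b1 + 2 * e by rewrite -Ee; ring.
  transitivity (2 * e * (u * a1 + v * a2) - 2 * e - 2 * a2 * (v * e)); first by ring.
  by rewrite Euv; ring.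
- apply/eqP; rewrite eqz_mod_dvd; apply/dvdzP.
  pose T1 := c1 + u * e * b1 + a1 * (u * e) ^+ 2.
  pose T2 := c2 - v * e * b2 + a2 * (v * e) ^+ 2.
  have H1 : (b1 + 2 * a1 * (u * e)) ^+ 2 - D = 4 * (a1 * T1) by rewrite E1 /T1; ring.
  have H2 : (b1 + 2 * a1 * (u * e)) ^+ 2 - D = 4 * (a2 * T2).
    have -> : b1 + 2 * a1 * (u * e) = b2 - 2 * a2 * (v * e).
      have -> : b2 = b1 + 2 * e * (u * a1 + v * a2) by rewrite Euv mulr1 -Ee; ring.
      ring.
    by rewrite E2 /T2; ring.
  exists (T2 * u + T1 * v); rewrite -[LHS]mulr1 -[X in _ * X]Euv.
  rewrite mulrDr {1}H2 H1; ring.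
Qed.

Lemma composition_exists D (X X' : framed D) : neg_discriminant D ->
  exists Y, composition X X' Y.
Proof.
move=> nD; have [D0 _] := nD.
have a0 := form_lead_gt0 (framed_isform X).
pose n := `|qa (framed_form X)|%N; have n0 : (0 < n)%N by rewrite absz_gt0 gt_eqF.
have U := framed_unit X'.
have [p [q [r [s [u [v [det Ex Ey]]]]]]] := strong_approximation n0 U.
have al1 : SL2 (mx2 p q r s) by apply/SL2_mx2.
have [X2 E2] := framed_act_exists X' D0 al1.
have EQ : framed_form X2 = qsubst (framed_form X') (mx2 p q r s) by rewrite /framed_form E2.
have Eg : framed_mx X2 = invmx (map_mx toZhat (mx2 p q r s)) *m framed_mx X'.
  by rewrite /framed_mx E2.
have co : gcdz (qa (framed_form X)) (qa (framed_form X2)) = 1.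
  set g := gcdz _ _; have [g1 Eg1] := dvdzP (dvdz_gcdl _ _ : (g %| qa (framed_form X))%Z).
  have [g2 Eg2] := dvdzP (dvdz_gcdr _ _ : (g %| qa (framed_form X2))%Z).
  have : (g %| 1)%Z.
    move: U Eg2; rewrite /lead_val /qval EQ qsubst2 /= Ex Ey.
    have -> : toZhat n = toZhat (g1 * g) by rewrite -Eg1 /n gez0_abs // ltW.
    move: (qa _) (qb _) (qc _) => a b c U Eg2.
    apply: (@unit_toZhat_dvd _ (toZhat g2 + toZhat g1 * (toZhat a * u * (2 * toZhat p +
      toZhat g1 * toZhat g * u)
      + toZhat b * (toZhat p * v + u * toZhat r + toZhat g1 * toZhat g * u * v)
      + toZhat c * v * (2 * toZhat r + toZhat g1 * toZhat g * v)))).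
    move: U; congr (_ \is a _).
    have Eg' : toZhat g * toZhat g2 = toZhat (a * p ^+ 2 + b * p * r + c * r ^+ 2).
      by rewrite -toZhatM [g * g2]mulrC -Eg2.
    rewrite [toZhat g * (_ + _)]mulrDr Eg' !expr2 !(toZhatD, toZhatM) /toZhat; ring.
  by rewrite dvdz1; have : 0 <= g by []; lia.
have [B con] := concordant_exists (framed_isform X) (framed_isform X2) co.
have [Y [EY Ymx]] := composed_exists D0 con nD.
by exists Y, (mx2 p q r s), B; rewrite /= -EQ -Eg.
Qed.

Lemma composition_spec D (X X' Y : framed D) : D < 0 -> composition X X' Y ->
  [/\ proportional D (framed_theta Y) (pmul (toZhat D) (framed_theta X) (framed_theta X')),
      lead_val Y = lead_val X * lead_val X'
    & mid_shift Y = (lead_val X')^-1 * mid_shift X + mid_shift X'].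
Proof.
move=> D0 [al [B [al1]]]; have [X2 E2] := framed_act_exists X' D0 al1.
have -> : qsubst (framed_form X') al = framed_form X2 by rewrite /framed_form E2.
have -> : invmx (map_mx toZhat al) *m framed_mx X' = framed_mx X2 by rewrite /framed_mx E2.
have [P EM] := (class_eqP X' X2 D0).1 (framed_act_class al1 E2).
move=> con EY Ymx; have [PY EN ES] := composition_invariants con EY Ymx.
rewrite EN ES EM (lead_val_class D0 P); split=> //.
by apply: proportional_trans PY _ => //; apply: proportional_mul => //;
  [exact: proportional_refl|exact: proportional_sym].
Qed.

Definition chat_theta D (c : Chat D) := framed_theta (repr c).
Definition chat_norm D (c : Chat D) := lead_val (repr c).
Definition chat_shift D (c : Chat D) := mid_shift (repr c).

Lemma chat_eqP D (c c' : Chat D) : D < 0 ->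
  c = c' <-> proportional D (chat_theta c) (chat_theta c') /\ chat_shift c = chat_shift c'.
Proof.
move=> D0; rewrite -(class_eqP _ _ D0) /Chat_class !reprK; split=> //.
Qed.

Lemma chat_class D (X : framed D) : D < 0 ->
  [/\ proportional D (chat_theta (Chat_class X)) (framed_theta X),
      chat_norm (Chat_class X) = lead_val X & chat_shift (Chat_class X) = mid_shift X].
Proof.
move=> D0; have [P E] : _ /\ _ := (class_eqP (repr (Chat_class X)) X D0).1 (reprK _).
by split=> //; exact: lead_val_class D0 P.
Qed.

Lemma chat_norm_class D (c c' : Chat D) : D < 0 ->
  proportional D (chat_theta c) (chat_theta c') -> chat_norm c = chat_norm c'.
Proof. by move=> D0; apply: lead_val_class. Qed.

Lemma chat_norm_unit D (c : Chat D) : chat_norm c \is a GRing.unit.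
Proof. exact: framed_unit. Qed.

Lemma chat_theta_regular D (c : Chat D) : D < 0 -> pregular D (chat_theta c).
Proof. by move=> D0; apply: theta_regular => //; [exact: framed_isform|exact: framed_unit]. Qed.

Lemma chat_mul_spec D (c c' : Chat D) : neg_discriminant D ->
  [/\ proportional D (chat_theta (Chat_mul c c')) (pmul (toZhat D) (chat_theta c) (chat_theta c')),
      chat_norm (Chat_mul c c') = chat_norm c * chat_norm c'
    & chat_shift (Chat_mul c c') = (chat_norm c')^-1 * chat_shift c + chat_shift c'].
Proof.
move=> nD; have [D0 _] := nD.
have : (exists X X' Y : framed D, [/\ c = Chat_class X, c' = Chat_class X',
    Chat_mul c c' = Chat_class Y & composition X X' Y]).
  rewrite /Chat_mul; case: xgetP => [d _ //|/(_ _)N].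
  have [Y HY] := composition_exists (repr c) (repr c') nD.
  case: (N (Chat_class Y)); exists (repr c), (repr c'), Y.
  by split=> //; rewrite /Chat_class reprK.
move=> [X [X' [Y [Ec Ec' EY /(composition_spec D0)[P N S]]]]].
have [PY NY SY] := chat_class Y D0; have [PX NX SX] := chat_class X D0.
have [PX' NX' SX'] := chat_class X' D0.
rewrite EY Ec Ec' NY SY NX SX NX' SX' N S; split=> //.
apply: (proportional_trans D0 PY); apply: (proportional_trans D0 P).
by apply: (proportional_mul D0); apply: proportional_sym.
Qed.

Lemma chat_exists D Q x y z : neg_discriminant D -> is_form D Q ->
  qval Q x y \is a GRing.unit ->
  exists c : Chat D, [/\ proportional D (chat_theta c) (theta Q x y),
    chat_norm c = qval Q x y & chat_shift c = 2 * z].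
Proof.
move=> nD FQ U; have [D0 _] := nD.
have [X [EQ Ex Ey Es]] := framed_exists z nD FQ U; exists (Chat_class X).
have [P N S] := chat_class X D0; rewrite N S Es; split=> //.
  by move: P; rewrite /framed_theta EQ Ex Ey.
by rewrite /lead_val EQ Ex Ey.
Qed.

(** * Change of order *)

Lemma Chat_isomorphic_sym D1 D2 : Chat_isomorphic D1 D2 -> Chat_isomorphic D2 D1.
Proof.
move=> [f [g fK gK] fM]; exists g; first by exists f.
by move=> c c'; apply: (can_inj fK); rewrite fM !gK.
Qed.

Lemma Chat_isomorphic_trans D1 D2 D3 :
  Chat_isomorphic D1 D2 -> Chat_isomorphic D2 D3 -> Chat_isomorphic D1 D3.
Proof.
move=> [f bf fM] [g bg gM]; exists (g \o f); first exact: bij_comp.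
by move=> c c' /=; rewrite fM gM.
Qed.

Lemma Chat_isomorphic_of_rel D1 D2 (r : Chat D1 -> Chat D2 -> Prop) :
  (forall c, exists d, r c d) -> (forall d, exists c, r c d) ->
  (forall c d d', r c d -> r c d' -> d = d') -> (forall c c' d, r c d -> r c' d -> c = c') ->
  (forall c c' d d', r c d -> r c' d' -> r (Chat_mul c c') (Chat_mul d d')) ->
  Chat_isomorphic D1 D2.
Proof.
move=> /choice[f rf] /choice[g rg] ud uc rM; exists f.
  by exists g => [c|d]; [apply: uc (rg _) (rf _)|apply: ud (rf _) (rg _)].
by move=> c c'; apply: (ud (Chat_mul c c')); [exact: rf|exact: rM].
Qed.

Lemma neg_discriminant_scale D f : neg_discriminant D -> f != 0 -> neg_discriminant (D * f ^+ 2).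
Proof.
move=> [D0 H] f0; have f2 : 0 < f ^+ 2 by rewrite lt0r sqr_ge0 sqrf_eq0 f0.
split; first by rewrite nmulr_rlt0.
have := divz_eq f 2; have := divz_eq D 4.
have : (f %% 2)%Z = 0 \/ (f %% 2)%Z = 1.
  have := modz_ge0 f (isT : 2 != 0 :> int); have := ltz_pmod f (isT : 0 < 2 :> int); lia.
move: (D %/ 4)%Z (D %% 4)%Z (f %/ 2)%Z (f %% 2)%Z H => d e g h He Hh ED Ef.
have Ef2 : f ^+ 2 = (g ^+ 2 + g * h) * 4 + h ^+ 2 by rewrite [in LHS]Ef; ring.
have -> : D * f ^+ 2 = (d * f ^+ 2 + e * (g ^+ 2 + g * h)) * 4 + e * h ^+ 2.
  by rewrite [in LHS]ED mulrDl [e * f ^+ 2]mulrC {2}Ef2; ring.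
by rewrite modzMDl; case: He => ->; case: Hh => ->; [left|left|left|right].
Qed.

Lemma adapted_representative D Q x y (n : nat) : D < 0 -> (0 < n)%N -> is_form D Q ->
  qval Q x y \is a GRing.unit ->
  exists Q1 x1 v, [/\ is_form D Q1, qval Q1 x1 (toZhat n * v) = qval Q x y
    & proportional D (theta Q1 x1 (toZhat n * v)) (theta Q x y)].
Proof.
move=> D0 n0 FQ U; have [p [q [r [s [u [v [det Ex Ey]]]]]]] := strong_approximation n0 U.
have zdet : toZhat p * toZhat s - toZhat q * toZhat r = 1.
  by rewrite -!toZhatM -toZhatN -toZhatD det.
have FQ1 := is_form_act D0 FQ det U.
pose x1 := toZhat s * x - toZhat q * y; pose v1 := toZhat p * v - toZhat r * u.
have E1 : toZhat p * x1 + toZhat q * (toZhat n * v1) = x.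
  transitivity ((toZhat p * toZhat s - toZhat q * toZhat r) * x); last by rewrite zdet mul1r.
  rewrite /x1 /v1 Ex Ey; ring.
have E2 : toZhat r * x1 + toZhat s * (toZhat n * v1) = y.
  transitivity ((toZhat p * toZhat s - toZhat q * toZhat r) * y); last by rewrite zdet mul1r.
  rewrite /x1 /v1 Ex Ey; ring.
exists (qsubst Q (mx2 p q r s)), x1, v1; split=> //.
  by rewrite qval_act E1 E2.
by have := theta_act x1 (toZhat n * v1) D0 FQ FQ1 det; rewrite E1 E2.
Qed.

(* The inclusion of Zhat[sqrt (D f^2)] in Zhat[sqrt D]. *)
Definition order_emb (f : int) (u : Zhat * Zhat) : Zhat * Zhat := (u.1, toZhat f * u.2).

Lemma order_embM D f u v : order_emb f (pmul (toZhat (D * f ^+ 2)) u v) =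
  pmul (toZhat D) (order_emb f u) (order_emb f v).
Proof. by rewrite /order_emb /pmul /= expr2 !toZhatM; congr pair; ring. Qed.

Lemma order_emb_proportional D f u v : f != 0 ->
  proportional (D * f ^+ 2) u v -> proportional D (order_emb f u) (order_emb f v).
Proof.
move=> f0 [[m1 m2] [[n1 n2] [m0 n0 E]]]; exists (m1, f * m2), (n1, f * n2).
have H (a b : int) : (a, b) != 0 -> (a, f * b) != 0.
  by rewrite -[0]/(0, 0) !xpair_eqE /= mulf_eq0 (negPf f0).
split; [exact: H|exact: H|].
have Z (a b : int) : zpair (a, f * b) = order_emb f (zpair (a, b)).
  by rewrite /zpair /order_emb /= toZhatM.
by rewrite !Z -!order_embM E.
Qed.

Lemma order_emb_inj f : f != 0 -> injective (order_emb f).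
Proof.
move=> f0 [a b] [a' b'] E; have /= -> := congr1 fst E.
by congr pair; apply: (toZhat_lreg f0); have /= := congr1 snd E.
Qed.

Lemma proportional_of_order_emb D f u v : f != 0 ->
  proportional D (order_emb f u) (order_emb f v) -> proportional (D * f ^+ 2) u v.
Proof.
move=> f0 [[m1 m2] [[n1 n2] [m0 n0 E]]]; exists (f * m1, m2), (f * n1, n2).
have H (a b : int) : (a, b) != 0 -> (f * a, b) != 0.
  by rewrite -[0]/(0, 0) !xpair_eqE /= mulf_eq0 (negPf f0).
split; [exact: H|exact: H|].
apply: (order_emb_inj f0); rewrite !order_embM.
have Z (a b : int) : order_emb f (zpair (f * a, b)) = pmul (toZhat D) (zpair (f, 0)) (zpair (a, b)).
  by rewrite /zpair /order_emb /pmul /= toZhatM toZhat0; congr pair; ring.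
by rewrite !Z -!pmulA E.
Qed.

Definition order_rel D f (c : Chat D) (c' : Chat (D * f ^+ 2)) : Prop :=
  [/\ proportional D (order_emb f (chat_theta c')) (chat_theta c),
      chat_norm c' = chat_norm c & chat_shift c' = chat_shift c].

Section OrderChange.
Variables (D f : int).
Hypothesis (nD : neg_discriminant D) (f0 : 0 < f).
Let D0 : D < 0 := proj1 nD.
Let fn0 : f != 0. Proof. by rewrite gt_eqF. Qed.
Let nD' := neg_discriminant_scale nD fn0.
Let D'0 : D * f ^+ 2 < 0 := proj1 nD'.
Let n := `|f|%N.
Let n0 : (0 < n)%N. Proof. by rewrite absz_gt0. Qed.
Let nf : Posz n = f. Proof. by rewrite /n gez0_abs // ltW. Qed.

Lemma order_rel_down (c : Chat D) : exists c', order_rel (f := f) c c'.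
Proof.
have [z Ez] := mid_shift_even (repr c) nD.
have UX := framed_unit (repr c).
have [[a b c1] [x1 [v [F1 E1 P1]]]] := adapted_representative D0 n0 (framed_isform (repr c)) UX.
rewrite nf in E1 P1.
pose Q' := QForm a (f * b) (f ^+ 2 * c1).
have EV : qval Q' x1 v = lead_val (repr c).
  by rewrite /lead_val -E1 /qval /= !expr2 !toZhatM; ring.
have F' : is_form (D * f ^+ 2) Q'.
  apply: (@is_form_of_unit _ _ x1 v) => //; last by rewrite EV.
    exact: (form_lead_gt0 F1).
  by rewrite (form_disc F1) /qdisc /=; ring.
have U' : qval Q' x1 v \is a GRing.unit by rewrite EV.
have [c' [P' N' S']] := chat_exists z nD' F' U'; exists c'; split.
- apply: proportional_trans P1 => //;
  apply: proportional_trans (order_emb_proportional fn0 P') _ => //.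
  rewrite (_ : order_emb f (theta Q' x1 v) = theta (QForm a b c1) x1 (toZhat f * v)).
    exact: proportional_refl.
  by rewrite /order_emb /theta /= toZhatM; congr pair; ring.
- by rewrite N' EV.
- by rewrite S' -Ez.
Qed.

Lemma order_rel_up (c' : Chat (D * f ^+ 2)) : exists c, order_rel (f := f) c c'.
Proof.
have [z Ez] := mid_shift_even (repr c') nD'.
have UX := framed_unit (repr c').
have [[a b c] [x1 [v [F1 E1 P1]]]] := adapted_representative D'0 n0 (framed_isform (repr c')) UX.
rewrite nf in E1 P1; have ED := form_disc F1; rewrite /= in ED.
have co : gcdz a f = 1.
  set g := gcdz _ _; have [g1 Eg1] := dvdzP (dvdz_gcdl _ _ : (g %| a)%Z).
  have [g2 Eg2] := dvdzP (dvdz_gcdr _ _ : (g %| f)%Z).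
  have : (g %| 1)%Z.
    apply: (@unit_toZhat_dvd _ (toZhat g1 * x1 ^+ 2 + toZhat b * x1 * (toZhat g2 * v)
      + toZhat c * toZhat g2 * v * (toZhat f * v))).
    move: UX; rewrite /lead_val -E1; congr (_ \is a _).
    by rewrite /qval /= Eg1 Eg2 !expr2 !toZhatM; ring.
  by rewrite dvdz1; have : 0 <= g by []; lia.
have [u [w Euw]] := Bezoutz a f; rewrite co in Euw.
have [d Ed] : exists d, D ^+ 2 - D = 4 * d.
  have [_ H] := nD; have := divz_eq D 4; move: (D %/ 4)%Z (D %% 4)%Z H => q e He ED4.
  exists (4 * q ^+ 2 + 2 * q * e - q); rewrite ED4; case: He => ->; ring.
have [e Ee] : exists e, b - D * f = 2 * e.
  apply: (@disc_parity _ _ (a * c) (f ^+ 2 * d)); rewrite mulrA -ED.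
  transitivity ((D * f) ^+ 2 - f ^+ 2 * (D ^+ 2 - D)); first by ring.
  by rewrite Ed; ring.
pose k := - (u * e); pose b1 := D + 2 * (w * e).
have Eb : b + 2 * a * k = f * b1.
  have -> : b = D * f + 2 * e * (u * a + w * f) by rewrite Euw -[b](subrK (D * f)) Ee; ring.
  by rewrite /k /b1; ring.
pose c2 := a * k ^+ 2 + b * k + c.
pose T := d + D * (w * e) + (w * e) ^+ 2.
have Eac : a * c2 = f ^+ 2 * T.
  apply: (@mulfI _ 4) => //.
  transitivity ((b + 2 * a * k) ^+ 2 - (b ^+ 2 - 4 * a * c)); first by rewrite /c2; ring.
  rewrite -ED Eb; transitivity (f ^+ 2 * ((D ^+ 2 - D) + 4 * (D * (w * e) + (w * e) ^+ 2))).
    by rewrite /b1; ring.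
  by rewrite Ed /T; ring.
pose c3 := T * (2 * u - a * u ^+ 2) + w ^+ 2 * c2.
have Ec2 : c2 = f ^+ 2 * c3.
  transitivity (a * c2 * (2 * u - a * u ^+ 2) + c2 * (1 - u * a) ^+ 2); first by ring.
  have -> : 1 - u * a = w * f by rewrite -Euw; ring.
  by rewrite Eac /c3; ring.
pose y1 := toZhat f * v; pose x2 := x1 - toZhat k * y1.
have det : 1 * 1 - k * 0 = 1 :> int by ring.
have U1 : qval (QForm a b c) x1 y1 \is a GRing.unit by rewrite E1.
have F2 := is_form_act D'0 F1 det U1.
have EQ2 : qsubst (QForm a b c) (mx2 1 k 0 1) = QForm a (f * b1) (f ^+ 2 * c3).
  by rewrite qsubst2 /= -Ec2 -Eb /c2; congr QForm; ring.
have P2 := theta_act x2 y1 D'0 F1 F2 det.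
have V2 := qval_act (QForm a b c) 1 k 0 1 x2 y1.
rewrite EQ2 !toZhat1 toZhat0 in P2 V2 F2.
have Ex : 1 * x2 + toZhat k * y1 = x1 by rewrite /x2; ring.
have Ey : 0 * x2 + 1 * y1 = y1 by ring.
rewrite {}Ex {}Ey in P2 V2.
have EV : qval (QForm a b1 c3) x2 (toZhat f * y1) = lead_val (repr c').
  by rewrite /lead_val -E1 -V2 /qval /= !expr2 !toZhatM; ring.
have F : is_form D (QForm a b1 c3).
  apply: (@is_form_of_unit _ _ x2 (toZhat f * y1)) => //; last by rewrite EV.
    exact: (form_lead_gt0 F1).
  apply: (@mulfI _ (f ^+ 2)); first by rewrite sqrf_eq0.
  by rewrite [RHS]mulrC (form_disc F2) /qdisc /=; ring.
have U : qval (QForm a b1 c3) x2 (toZhat f * y1) \is a GRing.unit by rewrite EV.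
have [c0 [P' N' S']] := chat_exists z nD F U; exists c0; split.
- apply: proportional_sym; apply: (proportional_trans D0 P').
  rewrite (_ : theta _ _ _ = order_emb f (theta (QForm a (f * b1) (f ^+ 2 * c3)) x2 y1)).
    exact/(order_emb_proportional fn0)/(proportional_trans D'0 P2).
  by rewrite /order_emb /theta /= toZhatM; congr pair; ring.
- by rewrite N' EV.
- by rewrite S' -Ez.
Qed.

Lemma chat_order_change : Chat_isomorphic D (D * f ^+ 2).
Proof.
apply: (@Chat_isomorphic_of_rel _ _ (order_rel (f := f))).
- exact: order_rel_down.
- exact: order_rel_up.
- move=> c d d' [P _ S] [P' _ S']; apply/(chat_eqP _ _ D'0); split; last by rewrite S.
  by apply: proportional_of_order_emb => //; apply: proportional_trans P _ => //;
    apply: proportional_sym.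
- move=> c c' d [P _ S] [P' _ S']; apply/(chat_eqP _ _ D0); split; last by rewrite -S.
  by apply: proportional_trans P' => //; apply: proportional_sym.
move=> c c' d d' [P N S] [P' N' S'].
have [Pc Nc Sc] := chat_mul_spec c c' nD; have [Pd Nd Sd] := chat_mul_spec d d' nD'.
split; rewrite ?Nc ?Nd ?Sc ?Sd ?N ?N' ?S ?S' //.
apply: (proportional_trans D0 (order_emb_proportional fn0 Pd)); rewrite order_embM.
by apply: (proportional_trans D0 (proportional_mul D0 P P')); apply: proportional_sym.
Qed.
End OrderChange.

(** * Isomorphisms preserve norms *)

Definition unipotent D (c : Chat D) : Prop := proportional D (chat_theta c) (1, 0).

Definition is_commutator D (c : Chat D) : Prop :=
  exists a b : Chat D, Chat_mul a b = Chat_mul (Chat_mul b a) c.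

(* x is 3 away from the prime 3, and 2 at 3. *)
Lemma unit_sqr_sub1_dvd24 : exists x t : Zhat, x \is a GRing.unit /\ (x ^+ 2 - 1) * t = 24.
Proof.
pose e := zhat_idem 3; have ee : e * e = e := zhat_idem_idem 3.
exists (3 * (1 - e) + 2 * e), (3 * (1 - e) + 8 * e); split; last first.
  transitivity (24 + (e * e - e) * (5 * e - 22)); last by rewrite ee subrr mul0r addr0.
  ring.
apply: zhat_unit_criterion => p pp [y E]; have [p3|p3] := eqVneq p 3%N.
  have [w Ew] := zhat_idem1 pp; move: E Ew; rewrite p3 -/e => E Ew.
  have : (3 %| 2)%Z by apply: (@toZhat_dvd _ _ (y + w)); rewrite /toZhat; move: E; rewrite Ew => E;
     transitivity (3%:R * y + 3 * w); [ring|rewrite -E; ring].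
  by [].
have co : coprime 3 p by rewrite prime_coprime // dvdn_prime2 // eq_sym.
have [w Ew] := zhat_idem0 (prime_gt0 pp) (isT : prime 3) co.
have : (p %| 3)%Z.
  apply: (@toZhat_dvd _ _ (y + w)); rewrite toZhat_nat mulrDr -E -Ew -/e /toZhat; ring.
move=> H; have : (p %| 3)%N := H; by rewrite dvdn_prime2 // (negPf p3).
Qed.

Section Unipotent.
Variable D : int.
Hypothesis nD : neg_discriminant D.
Let D0 : D < 0 := proj1 nD.

Lemma principal_unit_exists (x z : Zhat) : x \is a GRing.unit ->
  exists c : Chat D, chat_norm c = x ^+ 2 /\ chat_shift c = 2 * z.
Proof.
move=> U; have E : qval (principal_form D) x 0 = x ^+ 2.
  by rewrite /qval principal_lead toZhat1; ring.
have UV : qval (principal_form D) x 0 \is a GRing.unit by rewrite E unitrX.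
by have [c [_ N S]] := chat_exists z nD (principal_is_form nD) UV; exists c; rewrite N E.
Qed.

Lemma unipotent_exists z : exists u : Chat D,
  [/\ unipotent u, chat_norm u = 1 & chat_shift u = 2 * z].
Proof.
have E : qval (principal_form D) 1 0 = 1 by rewrite /qval principal_lead toZhat1; ring.
have UV : qval (principal_form D) 1 0 \is a GRing.unit by rewrite E unitr1.
have [c [P N S]] := chat_exists z nD (principal_is_form nD) UV; exists c; split=> //.
  apply: (proportional_trans D0 P); exists (1, 0), (2, 0); split=> //.
  by rewrite pmul1 /theta principal_lead /pmul /zpair /= toZhat1 toZhat0; congr pair;
    rewrite /toZhat; ring.
by rewrite N E.
Qed.

Lemma unipotent_norm (u : Chat D) : unipotent u -> chat_norm u = 1.
Proof.
move=> H; have [v [Hv <- _]] := unipotent_exists 0.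
by apply: (chat_norm_class D0); apply: (proportional_trans D0 H); apply: proportional_sym.
Qed.

Lemma unipotent_eq (u v : Chat D) : unipotent u -> unipotent v ->
  chat_shift u = chat_shift v -> u = v.
Proof.
move=> Hu Hv E; apply/(chat_eqP _ _ D0); split=> //.
by apply: (proportional_trans D0 Hu); apply: proportional_sym.
Qed.

Lemma unipotent_mul (u v : Chat D) : unipotent u -> unipotent v -> unipotent (Chat_mul u v).
Proof.
move=> Hu Hv; have [P _ _] := chat_mul_spec u v nD.
by apply: (proportional_trans D0 P); have := proportional_mul D0 Hu Hv; rewrite pmul1.
Qed.

Lemma unipotent_mul_shift (u v : Chat D) : unipotent v ->
  chat_shift (Chat_mul u v) = chat_shift u + chat_shift v.
Proof.
by move=> Hv; have [_ _ ->] := chat_mul_spec u v nD; rewrite unipotent_norm // invr1 mul1r.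
Qed.

Lemma commutator_unipotent (c : Chat D) : is_commutator c -> unipotent c.
Proof.
move=> [a [b E]]; have [P _ _] := chat_mul_spec a b nD.
have [P1 _ _] := chat_mul_spec b a nD; have [P2 _ _] := chat_mul_spec (Chat_mul b a) c nD.
apply: (@proportional_cancel D (pmul (toZhat D) (chat_theta a) (chat_theta b))).
  by apply: pregularM; apply: chat_theta_regular.
rewrite [X in proportional D _ X]pmulC pmul1; apply: proportional_sym.
apply: proportional_trans (proportional_sym P) _ => //; rewrite E.
apply: proportional_trans P2 _ => //; apply: proportional_mul => //; last exact: proportional_refl.
by rewrite pmulC.
Qed.

Lemma unipotent_commutator (c : Chat D) z : unipotent c -> chat_shift c = 2 * (24 * z) ->
  is_commutator c.
Proof.
move=> Hc Sc; have [x [t [Ux Et]]] := unit_sqr_sub1_dvd24.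
have [a [Na Sa]] := principal_unit_exists 0 Ux.
have [b [Hb Nb Sb]] := unipotent_exists (x ^+ 2 * t * z); exists a, b.
have [P _ S] := chat_mul_spec a b nD; have [P1 _ S1] := chat_mul_spec b a nD.
have [P2 _ _] := chat_mul_spec (Chat_mul b a) c nD.
apply/(chat_eqP _ _ D0); split.
  apply: (proportional_trans D0 P); apply: proportional_sym; apply: (proportional_trans D0 P2).
  rewrite -[X in proportional D _ X](pmul1 (toZhat D)) [pmul _ (1, 0) _]pmulC;
    apply: (proportional_mul D0) => //.
  by rewrite pmulC.
rewrite (unipotent_mul_shift a Hb) (unipotent_mul_shift _ Hc) S1 Na Sa Sb Sc -Et.
have K : (x ^+ 2)^-1 * x ^+ 2 = 1 by rewrite mulVr // unitrX.
move: (x ^+ 2)^-1 K => w K.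
transitivity (2 * (w * x ^+ 2) * (t * z) + 2 * ((x ^+ 2 - 1) * t * z)); last by ring.
by rewrite K; ring.
Qed.
End Unipotent.

Lemma morph_commutator D1 D2 (f : Chat D1 -> Chat D2) c :
  {morph f : c c' / Chat_mul c c' >-> Chat_mul c c'} -> is_commutator c -> is_commutator (f c).
Proof. by move=> fM [a [b E]]; exists (f a), (f b); rewrite -!fM E. Qed.

(* Conjugation by c acts on the unipotent classes as multiplication by the
   inverse of the norm of c, and an isomorphism respects the Zhat-linear
   structure of the commutators because additive maps of Zhat are linear. *)
Lemma iso_norm D1 D2 (f : Chat D1 -> Chat D2) :
  neg_discriminant D1 -> neg_discriminant D2 -> injective f ->
  {morph f : c c' / Chat_mul c c' >-> Chat_mul c c'} ->
  forall c, chat_norm (f c) = chat_norm c.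
Proof.
move=> n1 n2 fI fM; have [D10 _] := n1; have [D20 _] := n2.
have /choice[u Hu] z : exists u : Chat D1,
    [/\ unipotent u, chat_norm u = 1 & chat_shift u = 2 * (24 * z)].
  exact: unipotent_exists.
have uU z : unipotent (u z) by case: (Hu z).
have uS z : chat_shift (u z) = 2 * (24 * z) by case: (Hu z).
have fU z : unipotent (f (u z)).
  apply: commutator_unipotent => //; apply: morph_commutator => //.
  exact: unipotent_commutator (uS z).
pose phi z := chat_shift (f (u z)).
have phiD : {morph phi : x y / x + y}.
  move=> x y; rewrite /phi -unipotent_mul_shift // -fM; congr (chat_shift (f _)).
  apply: unipotent_eq => //; first exact: unipotent_mul.
  by rewrite unipotent_mul_shift // !uS; ring.
have phiE := zhat_additive_linear phiD.
have phi_inj x : x * phi 1 = 0 -> x = 0.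
  rewrite -phiE => E; have /fI/(congr1 (@chat_shift D1)) : f (u x) = f (u 0).
    by apply: unipotent_eq => //; rewrite -/(phi x) -/(phi 0) E phiE mul0r.
  by rewrite !uS !mulr0 => /(@toZhat_reg 2) /= /(_ isT)/(@toZhat_reg 24) /= /(_ isT).
move=> c; set N := chat_norm c; have UN : N \is a GRing.unit := chat_norm_unit c.
have UM : chat_norm (f c) \is a GRing.unit := chat_norm_unit (f c).
have conj : Chat_mul c (u N^-1) = Chat_mul (u 1) c.
  have [P _ S] := chat_mul_spec c (u N^-1) n1; have [P' _ S'] := chat_mul_spec (u 1) c n1.
  apply/(chat_eqP _ _ D10); split; last first.
    by rewrite unipotent_mul_shift // S' !uS -/N; ring.
  apply: (proportional_trans D10 P); apply: proportional_sym; apply: (proportional_trans D10 P').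
  rewrite [X in proportional D1 _ X]pmulC; apply: (proportional_mul D10);
    last exact: proportional_refl.
  by apply: (proportional_trans D10 (uU 1)); apply: proportional_sym; exact: uU.
have := congr1 (fun d => chat_shift (f d)) conj; rewrite !fM unipotent_mul_shift //.
have [_ _ ->] := chat_mul_spec (f (u 1)) (f c) n2.
rewrite -/(phi 1) -/(phi N^-1) phiE addrC => /addIr/eqP;
  rewrite -subr_eq0 -mulrBl => /eqP/phi_inj/eqP.
by rewrite subr_eq0 => /eqP/invr_inj.
Qed.

(** * Quadratic fields and split primes *)

Lemma Qsqrt_gen D : Qsqrt D (sqrtC D%:~R).
Proof. by move=> K [_]; apply. Qed.

Lemma Qsqrt_closed D (K : set algC) : divring_closed (mem K) -> K (sqrtC D%:~R) ->
  forall x, Qsqrt D x -> K x.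
Proof. by move=> KC Ks x; apply; split=> // y ->. Qed.

Lemma divring_intr (K : set algC) (n : int) : divring_closed (mem K) -> n%:~R \in K.
Proof.
move=> [K1 KB _]; have K0 : 0 \in K by rewrite -(subrr 1); apply: (KB).
have KN x : x \in K -> - x \in K by move=> Kx; rewrite -(sub0r x); apply: (KB).
have KD x y : x \in K -> y \in K -> x + y \in K.
  by move=> Kx Ky; rewrite -(opprK y); apply: (KB) => //; apply: (KN).
have Kn (m : nat) : m%:R \in K.
  by elim: m => [|m IH] //; rewrite -addn1 natrD; apply: (KD).
by case: n => m; [|rewrite NegzE mulrNz; apply: (KN)]; apply: Kn.
Qed.

Lemma Qsqrt_subset (D1 D2 f1 f2 : int) : f1 != 0 -> D1 * f1 ^+ 2 = D2 * f2 ^+ 2 ->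
  (Qsqrt D1 `<=` Qsqrt D2)%classic.
Proof.
move=> f10 E x Hx K [KC Ks]; apply: (Qsqrt_closed KC) Hx.
have [_ KB KV] := KC; have Kn n := divring_intr n KC.
have KM y z : y \in K -> z \in K -> y * z \in K.
  by move=> Ky Kz; rewrite -[z]invrK; apply: (KV) => //; rewrite -div1r; apply: (KV) => //;
    case: KC.
have s2 : sqrtC D2%:~R \in K by rewrite inE; apply: Ks.
have f1C : f1%:~R != 0 :> algC by rewrite intr_eq0.
have : (sqrtC D1%:~R * f1%:~R) ^+ 2 == (sqrtC D2%:~R * f2%:~R) ^+ 2 :> algC.
  by rewrite !exprMn !sqrtCK -!rmorphXn -!rmorphM /= E.
rewrite eqf_sqr => H; rewrite -in_setE -[sqrtC D1%:~R](mulfK f1C); apply: (KV) => //.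
case/orP: H => /eqP ->; first exact: KM.
by rewrite -mulrN -mulrNz; apply: (KM).
Qed.

Lemma sqrtC_neg_irrational (D : int) (q : rat) : D < 0 -> sqrtC D%:~R <> ratr q :> algC.
Proof.
move=> D0 /(congr1 (fun x => x ^+ 2)); rewrite sqrtCK -rmorphXn -(ratr_int _ D).
move=> /fmorph_inj E; have : 0 <= q ^+ 2 := sqr_ge0 q.
by rewrite -E ler0z leNgt D0.
Qed.

Lemma Qsqrt_rat (D : int) : D < 0 -> forall x, Qsqrt D x ->
  exists a b : rat, x = ratr a + ratr b * sqrtC D%:~R.
Proof.
move=> D0; set s := sqrtC _; have ss : s * s = ratr D%:~R by rewrite -expr2 sqrtCK ratr_int.
apply: Qsqrt_closed; last by exists 0, 1; rewrite !rmorph0 rmorph1 add0r mul1r.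
split.
- by rewrite in_setE; exists 1, 0; rewrite rmorph1 rmorph0 mul0r addr0.
- move=> x y; rewrite !in_setE => -[a [b ->]] [c [d ->]]; exists (a - c), (b - d).
  by rewrite !rmorphB /=; ring.
move=> x y; rewrite !in_setE => -[a [b ->]] [c [d ->]].
pose n := c ^+ 2 - d ^+ 2 * D%:~R.
have [n0|n0] := eqVneq n 0.
  have Dr : 0 < - D%:~R :> rat by rewrite oppr_gt0 ltrz0.
  have c0 := sqr_ge0 c; have d0 := sqr_ge0 d.
  have cd : c ^+ 2 = 0 /\ d ^+ 2 * - D%:~R = 0.
    have : 0 <= d ^+ 2 * - D%:~R by rewrite mulr_ge0 // ltW.
    by move: n0; rewrite /n; lra.
  have /eqP := cd.1; rewrite sqrf_eq0 => /eqP ->.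
  have /eqP := cd.2; rewrite mulf_eq0 sqrf_eq0 (gt_eqF Dr) orbF => /eqP ->.
  by exists 0, 0; rewrite !rmorph0 !mul0r !addr0 invr0 mulr0.
have n0C : ratr n != 0 :> algC by rewrite fmorph_eq0.
have En : (ratr c + ratr d * s) * (ratr c - ratr d * s) = ratr n :> algC.
  transitivity (ratr c ^+ 2 - ratr d ^+ 2 * (s * s) : algC); first by ring.
  by rewrite ss /n rmorphB rmorphM /= !expr2 !rmorphM.
clearbody n.
exists ((a * c - b * d * D%:~R) / n), ((b * c - a * d) / n).
have y0 : ratr c + ratr d * s != 0 :> algC.
  by apply: contra_neq n0C => y0; rewrite -En y0 mul0r.
apply: (mulIf y0); rewrite mulfVK //; apply: (mulIf n0C).
rewrite !fmorph_div rmorphB !rmorphM /= !rmorphB !rmorphM /= -ss.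
transitivity ((((ratr a * ratr c - ratr b * ratr d * (s * s)) + (ratr b * ratr c -
  ratr a * ratr d) * s)
   * (ratr c + ratr d * s)) * (ratr n / ratr n) : algC); last by ring.
rewrite divff // mulr1 -En; ring.
Qed.

Lemma Qsqrt_eqP (D1 D2 : int) : D1 < 0 -> D2 < 0 ->
  Qsqrt D1 = Qsqrt D2 <-> exists f1 f2 : int, [/\ f1 != 0, f2 != 0 & D1 * f1 ^+ 2 = D2 * f2 ^+ 2].
Proof.
move=> D10 D20; split; last first.
  by move=> [f1 [f2 [f10 f20 E]]]; apply/seteqP; split;
    apply: Qsqrt_subset E || apply: Qsqrt_subset (esym E).
move=> E; have := @Qsqrt_gen D1; rewrite E => /(Qsqrt_rat D20)[a [b Es]].
have := congr1 (fun x => x ^+ 2) Es; rewrite sqrtCK; set s := sqrtC D2%:~R in Es *.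
have ss : s * s = ratr D2%:~R by rewrite -expr2 sqrtCK ratr_int.
have [a0|a0] := eqVneq a 0; last first.
  have [b0|b0] := eqVneq b 0.
    by case: (sqrtC_neg_irrational D10 (q := a)); rewrite Es b0 rmorph0 mul0r addr0.
  move=> F; case: (sqrtC_neg_irrational D20 (q := (D1%:~R - a ^+ 2 -
    b ^+ 2 * D2%:~R) / (2 * a * b))).
  have ab0 : 2 * a * b != 0 by rewrite !mulf_neq0.
  have ab0C : ratr (2 * a * b) != 0 :> algC by rewrite fmorph_eq0.
  rewrite fmorph_div; apply: (canRL (mulfK ab0C)) => /=.
  have -> : ratr (D1%:~R - a ^+ 2 - b ^+ 2 * D2%:~R) =
      D1%:~R - ratr a ^+ 2 - ratr b ^+ 2 * (s * s) :> algC.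
    by rewrite ss -(ratr_int _ D1) -!rmorphXn -rmorphM -!rmorphB.
  have -> : ratr (2 * a * b) = 2 * ratr a * ratr b :> algC by rewrite !rmorphM /= rmorph_nat.
  rewrite F -/s; ring.
rewrite a0 rmorph0 add0r exprMn [s ^+ 2]expr2 ss -rmorphXn -rmorphM -(ratr_int _ D1) => /fmorph_inj F.
exists (denq b), (numq b); have b0 : b != 0.
  apply/eqP => b0; move: F; rewrite b0 expr0n mul0r => /eqP; rewrite intr_eq0 => /eqP D1E.
  by rewrite D1E ltxx in D10.
rewrite denq_neq0 numq_eq0 b0; split=> //; apply: (@intr_inj rat).
rewrite !expr2 !intrM -!expr2 F -{1}(divq_num_den b).
have d0 : (denq b)%:~R != 0 :> rat by rewrite intr_eq0 denq_neq0.
by field.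
Qed.

(* The form (p, b, c) takes the value p at (1, 0) and c at (0, 1), and p does not
   divide c; the idempotent at p glues (0, 1) at p with (1, 0) elsewhere. *)
Lemma split_prime_norm (D : int) (p n : nat) : neg_discriminant D -> prime p -> odd p ->
  coprime p `|D| -> is_sqr_mod p D -> (0 < n)%N -> coprime p n ->
  exists (c : Chat D) (z : Zhat), chat_norm c = toZhat p + toZhat n * z.
Proof.
move=> nD pp op cD [x [y0 Exy]] n0 cn; have [D0 HD] := nD.
have p1 := prime_gt1 pp.
have [d Ed] : exists d, D ^+ 2 - D = 4 * d.
  have := divz_eq D 4; move: (D %/ 4)%Z (D %% 4)%Z HD => q e He ED4.
  exists (4 * q ^+ 2 + 2 * q * e - q); rewrite ED4; case: He => ->; ring.
have pD : ~~ (p %| D)%Z by rewrite dvdzE /= -prime_coprime.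
have [b [c [Ebc pc]]] : exists b c : int, b ^+ 2 - 4 * p%:Z * c = D /\ ~~ (p %| c)%Z.
  have [m Em] : exists m : nat, p = m.*2.+1 by exists p./2; lia.
  pose b := x + p%:Z * (x - D).
  have [c Ec] : exists c, b ^+ 2 - D = 4 * p%:Z * c.
    have /dvdzP[c Ec] : (4 * p%:Z %| b ^+ 2 - D)%Z.
      rewrite Gauss_dvdz; last by rewrite /coprimez /gcdz /= (eqP (coprime_exp2 2 op)).
      apply/andP; split; apply/dvdzP.
        have -> : b = D + 2 * ((x - D) * (m%:Z + 1)).
          by rewrite /b Em -addn1 -muln2 PoszD PoszM; ring.
        exists (d + D * ((x - D) * (m%:Z + 1)) + ((x - D) * (m%:Z + 1)) ^+ 2).
        transitivity ((D ^+ 2 - D) + 4 * (D * ((x - D) * (m%:Z + 1)) + ((x - D) * (m%:Z +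
          1)) ^+ 2)).
          by ring.
        by rewrite Ed; ring.
      exists (y0 + 2 * x * (x - D) + p%:Z * (x - D) ^+ 2).
      transitivity ((x ^+ 2 - D) + p%:Z * (2 * x * (x - D) + p%:Z * (x - D) ^+ 2)).
        by rewrite /b; ring.
      by rewrite Exy; ring.
    by exists c; rewrite Ec; ring.
  have [pc|pc] := boolP (p %| c)%Z; last by exists b, c; split=> //; rewrite -Ec; ring.
  exists (b + 2 * p%:Z), (c + b + p%:Z); split.
    transitivity ((b ^+ 2 - 4 * p%:Z * c)); first by ring.
    by rewrite -Ec; ring.
  apply: contra pD => /dvdzP[k2 Ek2]; have [k Ek] := dvdzP pc.
  have Eb : b = (k2 - k - 1) * p%:Z.
    have -> : b = (c + b + p%:Z) - c - p%:Z by ring.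
    by rewrite Ek2 Ek; ring.
  apply/dvdzP; exists ((k2 - k - 1) * b - 4 * c).
  transitivity ((k2 - k - 1) * p%:Z * b - 4 * p%:Z * c); last by ring.
  by rewrite -Eb -Ec; ring.
pose e := zhat_idem p; have ee : e * e = e := zhat_idem_idem p.
pose Q := QForm p%:Z b c.
have EV : qval Q (1 - e) e = toZhat p * (1 - e) + toZhat c * e.
  rewrite /qval /=.
  transitivity (toZhat p * (1 - e) + toZhat c * e + (e * e - e) * (toZhat p - toZhat b + toZhat c)).
    by ring.
  by rewrite ee subrr mul0r addr0.
have U : qval Q (1 - e) e \is a GRing.unit.
  apply: zhat_unit_criterion => l pl [y]; rewrite EV -toZhat_nat => E.
  have [lp|lp] := eqVneq l p.
    have [w] := zhat_idem1 pp; rewrite -/e -toZhat_nat => Ew.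
    apply: (negP pc); rewrite -lp; apply: (@toZhat_dvd _ _ (y + w * toZhat p - toZhat c * w)).
    rewrite mulrBr mulrDr -E Ew lp; ring.
  have col : coprime p l by rewrite prime_coprime // dvdn_prime2 // eq_sym.
  have [w] := zhat_idem0 (prime_gt0 pl) pp col; rewrite -/e -toZhat_nat => Ew.
  have : (l %| p%:Z)%Z.
    apply: (@toZhat_dvd _ _ (y + w * toZhat p - w * toZhat c)).
    rewrite mulrBr mulrDr -E Ew; ring.
  by rewrite dvdzE /= dvdn_prime2 // (negPf lp).
have FQ : is_form D Q.
  by apply: is_form_of_unit U => //; rewrite /Q /= ltz_nat prime_gt0.
have [k [_ Nk _]] := chat_exists 0 nD FQ U; exists k.
have [w] := zhat_idem0 n0 pp cn; rewrite -/e -toZhat_nat => Ew.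
exists (w * (toZhat c - toZhat p)); rewrite Nk EV Ew; ring.
Qed.

Lemma norm_is_sqr_mod (D : int) (p : nat) (c : Chat D) (z : Zhat) : neg_discriminant D ->
  prime p -> odd p -> coprime `|D| p ->
  chat_norm c = toZhat p + toZhat (4 * `|D|)%N * z -> is_sqr_mod p D.
Proof.
move=> nD pp op co; have [D0 _] := nD; have d0 : (0 < `|D|)%N by rewrite absz_gt0 lt_eqF.
have F := framed_isform (repr c); have U := framed_unit (repr c).
have n0 : (0 < 4 * `|D|)%N by rewrite muln_gt0.
have [x0 [q [r [s [u [v [det Ex Ey]]]]]]] := strong_approximation n0 U.
have Fa := is_form_act D0 F det U.
move: Fa (form_lead_gt0 Fa) (form_disc Fa); rewrite qsubst2 /=.
rewrite /chat_norm /lead_val Ex Ey.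
case: (framed_form _) => a b c1 /=; set m := (4 * `|D|)%N.
set A := a * x0 ^+ 2 + _ + _; set B := 2 * a * x0 * q + _ + _; set C := a * q ^+ 2 + _ + _.
move=> _ A0 ED; rewrite /qval /= => EN.
have dvd : (m %| A - p%:Z)%Z.
  apply: (@toZhat_dvd _ _ (z - toZhat a * (2 * toZhat x0 * u + toZhat m * u ^+ 2)
     - toZhat b * (toZhat x0 * v + u * toZhat r + toZhat m * u * v)
     - toZhat c1 * (2 * toZhat r * v + toZhat m * v ^+ 2))).
  rewrite !mulrBr -[toZhat m * z](addKr (toZhat p)) -EN /A !expr2 !(toZhatD, toZhatM, toZhatN).
  by rewrite /toZhat; ring.
have EA : Posz `|A| = A by rewrite gez0_abs // ltW.
have mod : (p = `|A| %[mod m])%N.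
  by apply/eqP; rewrite -eqz_nat -!modz_nat EA eq_sym eqz_mod_dvd.
have coA : coprime m `|A|.
  rewrite coprime_sym -coprime_modl -mod coprime_modl coprime_sym /m coprimeMl co andbT.
  exact: (coprime_exp2 2).
move: coA; rewrite /m coprimeMl => /andP[c4 cA].
have oA : odd `|A| by move: c4; rewrite -[4%N]/(2 ^ 2)%N coprime_pexpl // coprime2n.
have -> : D = - (`|D|%N)%:Z by rewrite abszE ltr0_norm // opprK.
apply: (@is_sqr_mod_periodic _ `|A|) => //.
exists B, (4 * C); rewrite abszE ltr0_norm // opprK EA ED; ring.
Qed.

Lemma iso_is_sqr_mod D1 D2 (p : nat) : neg_discriminant D1 -> neg_discriminant D2 ->
  Chat_isomorphic D1 D2 -> prime p -> odd p -> coprime p `|D1| -> coprime p `|D2| ->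
  is_sqr_mod p D1 -> is_sqr_mod p D2.
Proof.
move=> n1 n2 [f bf fM] pp op c1 c2 R.
have d2 : (0 < `|D2|)%N by have [D20 _] := n2; rewrite absz_gt0 lt_eqF.
have c4 : coprime p (4 * `|D2|) by rewrite coprimeMr c2 andbT coprime_sym (coprime_exp2 2).
have d4 : (0 < 4 * `|D2|)%N by rewrite muln_gt0.
have [c [z Nc]] := split_prime_norm n1 pp op c1 R d4 c4.
apply: (@norm_is_sqr_mod _ _ (f c) z) => //; first by rewrite coprime_sym.
by rewrite (iso_norm n1 n2 (bij_inj bf) fM).
Qed.

Lemma is_sqr_modM_prime (p : nat) (m n : int) : prime p -> odd p ->
  (is_sqr_mod p m <-> is_sqr_mod p n) -> coprime p `|m| -> coprime p `|n| -> is_sqr_mod p (m * n).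
Proof.
move=> pp op H cm cn; have Ep : p = (p./2).*2.+1 by lia.
have [Rm|Nm] := EM (is_sqr_mod p m).
  have [x [y Exy]] := Rm; have [z [w Ezw]] := H.1 Rm.
  exists (x * z), (y * z ^+ 2 + w * m).
  transitivity ((x ^+ 2 - m) * z ^+ 2 + m * (z ^+ 2 - n)); first by ring.
  by rewrite Exy Ezw; ring.
have Nn : ~ is_sqr_mod p n by move/H.2.
have red (k : int) : coprime p `|k| -> ~ is_sqr_mod p k ->
    exists a : nat, [/\ exists z, k - a%:Z = p%:Z * z, coprime a p & ~ is_sqr_mod p a].
  move=> ck Nk; pose a := `|(k %% p)%Z|%N.
  have Ea : a%:Z = (k %% p)%Z by rewrite gez0_abs // modz_ge0 //; case: (p) pp.
  have Ek : k - a%:Z = p%:Z * (k %/ p)%Z by rewrite Ea {1}(divz_eq k p); ring.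
  exists a; split; first by exists (k %/ p)%Z.
    rewrite coprime_sym prime_coprime //; move: ck; rewrite prime_coprime //; apply: contra => D.
    have [w Ew] := dvdnP D; suff : (p %| k)%Z by rewrite dvdzE.
    apply/dvdzP; exists (w%:Z + (k %/ p)%Z).
    by rewrite {1}(divz_eq k p) -Ea Ew PoszM; ring.
  by move=> Ra; apply: Nk; exact: is_sqr_mod_congr Ek Ra.
have [a [[z1 E1] ca Na]] := red m cm Nm; have [b [[z2 E2] cb Nb]] := red n cn Nn.
have : is_sqr_mod p (a * b)%N.
  apply: contrapT => Nab.
  have cab : coprime (a * b) p by rewrite coprimeMl ca.
  rewrite Ep in Na Nb Nab pp ca cb cab.
  have := gauss_prime pp cab Nab; rewrite gaussM //.
  by rewrite !(gauss_prime pp).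
apply: (@is_sqr_mod_congr _ _ _ (z1 * n + a%:Z * z2)).
transitivity ((m - a%:Z) * n + a%:Z * (n - b%:Z)); first by rewrite PoszM; ring.
by rewrite E1 E2; ring.
Qed.

Theorem theorem12p6 (D1 D2 : int)
  (hD1 : neg_discriminant D1) (hD2 : neg_discriminant D2) :
  Chat_isomorphic D1 D2 <-> Qsqrt D1 = Qsqrt D2.
Proof.
have [D10 _] := hD1; have [D20 _] := hD2; rewrite (Qsqrt_eqP D10 D20); split; last first.
  move=> [f1 [f2 [f10 f20 E]]].
  have scale D f : neg_discriminant D -> f != 0 -> Chat_isomorphic D (D * f ^+ 2).
    move=> nD f0; rewrite -(real_normK (num_real f)); apply: chat_order_change => //.
    by rewrite normr_gt0.
  apply: Chat_isomorphic_trans (scale _ _ hD1 f10) _; rewrite E; exact/Chat_isomorphic_sym/scale.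
move=> iso; pose n := (`|D1| * `|D2|)%N.
have En : n%:Z = D1 * D2 by rewrite /n PoszM !abszE !ltr0_norm // mulrNN.
have n0 : (0 < n)%N by rewrite muln_gt0 !absz_gt0 !lt_eqF.
have [p pp op|s Es] := square_of_local_squares n0.
  rewrite /n coprimeMr => /andP[c1 c2]; rewrite -/n En; apply: is_sqr_modM_prime => //.
  by split; [apply: iso_is_sqr_mod iso _ _ _ _|apply: iso_is_sqr_mod (Chat_isomorphic_sym iso) _ _ _ _].
have EZ : D1 * D2 = s%:Z ^+ 2 by rewrite -En Es -!natz natrX.
exists D2, s%:Z; split; first by rewrite lt_eqF.
  by apply/eqP => s0; move: n0; rewrite Es; move: s0 => /eqP; rewrite eqz_nat => /eqP ->.
by rewrite -EZ; ring.
Qed.
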